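(* Fix an integer $z\ge1$. For $k\ge1$ let $P_z(k)$ be the proportion of integers $n\in[0,k^2+k)$ for which $N(n,k)=z$. Then $P_z(k)\to \frac{3}{\pi^2}\left(\frac{1}{z^2}+\frac{1}{(z+1)^2}\right)$ as $k\to\infty$.
   Context: For $n>k\ge1$, $N(n,k)$ is the nullity of the $n\times n$ skew-symmetric Toeplitz matrix $A(n,k)$ whose first $k$ superdiagonals have all entries $1$ and whose remaining superdiagonals have all entries $0$. This nullity depends only on $n\bmod (k^2+k)$, and $N(n,k)$ is defined for every integer $n$ as $N(n',k)$ for any $n'>k$ with $n'\equiv n\pmod{k^2+k}$. *)

(* Defs.v *)
From HB Require Import structures.
From mathcomp Require Import all_boot all_order all_algebra.
From mathcomp Require Import all_classical all_reals all_analysis.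
Set Implicit Arguments. Unset Strict Implicit. Unset Printing Implicit Defensive.
Import Order.TTheory GRing.Theory Num.Theory.
Local Open Scope ring_scope.

Definition Amat (n k : nat) : 'M[rat]_n :=
  \matrix_(i < n, j < n)
    if ((i < j) && (j <= i + k))%N then 1
    else if ((j < i) && (i <= j + k))%N then -1 else 0.

Definition nullity (n : nat) (A : 'M[rat]_n) : nat := (n - \rank A)%N.

(* N(n,k) for 0 <= n : for n > k it is the nullity of A(n,k); otherwise
   (per the paper) it is N(n',k) for a representative n' > k, n' = n mod (k^2+k);
   we take n' = n + (k^2 + k). *)
Definition Nnull (n k : nat) : nat :=
  if (k < n)%N then nullity (Amat n k)
  else nullity (Amat (n + (k ^ 2 + k)) k).

Definition Pz (R : realType) (z k : nat) : R :=
  (#|[set n : 'I_(k ^ 2 + k) | Nnull n k == z]|)%:R / (k ^ 2 + k)%:R.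

(* Main.v *)
(**
  A vector [v] of the kernel of [A(n,k)], read as a polynomial [V], is characterised by
  [g V = p + X^(n+k) q] with [p], [q] of degree less than [k], where
  [g = (X^k - 1)(1 + X + ... + X^k)].  A polynomial is divisible by [g] iff it is divisible by
  [X^k - 1] and [X^(k+1) - 1], so the kernel is governed by cyclic shifts modulo [k] and
  modulo [k + 1].

  For [y <= k] and [c] coprime to [y] put [k = m y + s] with [s < y].  Staircase sequences with
  steps [m] and [m + 1] give an explicit pair [(p, q)] of degree [k - m], admissible for one
  residue [n] modulo [k^2 + k]; multiplying [p] or [q] by [X^j], [j <= m], gives pairs of degree
  [k - m + j] for the residues [n + j] and [n - j].  A degree bound on [p' q - p q'] shows that
  such a pair generates all admissible pairs, so the nullity there is [m - j].  The nullity as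
  a function of [n] is thus made of "tents" of height [m = k %/ y], one for each reduced
  fraction [c / y].  The tents are disjoint, and counting shows that they fill a whole period.

  Indexing the tents by the pairs [0 <= X < Y <= k], two residues being attached to each pair,
  with nullities [gcd(X, Y)] and [gcd(X, Y) - 1], the number of [n] of nullity [z] is
  [G_z(k) + G_(z+1)(k)], where [G_z(k)] counts the pairs with gcd [z].  Finally
  [G_z(k) = G_1(k %/ z)] and [sum_z G_1(k %/ z) = k (k + 1) / 2] force [G_1(k) ~ 3 k^2 / pi^2]:
  the error term is contracted by a factor [sum_(z >= 2) 1 / z^2 < 1], and the constant comes
  from [sum 1 / z^2 = pi^2 / 6].
*)
Require Import Defs.
From HB Require Import structures.
From mathcomp Require Import all_boot all_order all_algebra.
From mathcomp Require Import cyclic zify ring lra.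
From mathcomp Require Import all_classical all_reals all_analysis.
Set Implicit Arguments. Unset Strict Implicit. Unset Printing Implicit Defensive.
Import Order.TTheory GRing.Theory Num.Theory numFieldNormedType.Exports.

(** * Staircase sequences *)

(* The marked gaps of the staircase.  With [b = false] there are [s + 1] of them per period [y],
   with [b = true] only [s], so that [stair b k y c] has quasi-period [k + 1 - b]. *)
Definition low (b : bool) (y c s l : nat) : bool := b <= l * c %% y <= s.

Definition stair (b : bool) (k y c i : nat) : nat :=
  k %/ y * i + \sum_(l < i) low b y c (k %% y) l.+1.

Definition invmod (y c : nat) : nat := c ^ (totient y).-1.

Lemma mul_invmod y c : 0 < y -> coprime c y -> c * invmod y c = 1 %[mod y].
Proof.
move=> y0 cy; rewrite /invmod -expnS prednK ?totient_gt0 //.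
exact: Euler_exp_totient.
Qed.

Lemma stairS b k y c i :
  stair b k y c i.+1 = stair b k y c i + k %/ y + low b y c (k %% y) i.+1.
Proof. by rewrite /stair big_ord_recr /= mulnS; lia. Qed.

Lemma stair0 b k y c : stair b k y c 0 = 0.
Proof. by rewrite /stair big_ord0 muln0. Qed.

Lemma ltn_stair b k y c : 0 < y <= k -> {mono stair b k y c : i j / i < j}.
Proof.
move=> /andP[y0 yk]; apply: leqW_mono; apply: leq_mono => i j ij.
have m0 : 0 < k %/ y by rewrite divn_gt0.
elim: j ij => // j IH; rewrite ltnS leq_eqVlt => /orP[/eqP->|/IH h]; rewrite stairS; lia.
Qed.

Lemma low_period b y c s l : low b y c s (l + y) = low b y c s l.
Proof. by rewrite /low mulnDl addnC [y * c]mulnC modnMDl. Qed.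

(** Since [c] is a unit modulo [y], the residues [l * c] run once through all classes, so the marked
    gaps are as many as the integers from [b] to [s]. *)
Lemma sum_low b y c s : coprime c y -> s < y ->
  \sum_(l < y) low b y c s l.+1 = s.+1 - b.
Proof.
case: y => // y cy sy.
have -> : \sum_(l < y.+1) low b y.+1 c s l.+1 = \sum_(l < y.+1) low b y.+1 c s l.
  rewrite big_ord_recr [RHS]big_ord_recl /= addnC; congr (_ + _).
  by rewrite -[in LHS](add0n y.+1) low_period.
pose h (l : 'I_y.+1) : 'I_y.+1 := inord (l * c %% y.+1).
have hE l : h l = l * c %% y.+1 :> nat by rewrite inordK // ltn_mod.
have hi : injective h.
  move=> l l' /(congr1 val); rewrite /= !hE => /eqP.
  wlog ll : l l' / l' <= l.
    by move=> W e; case/orP: (leq_total l l') => h'; [apply/esym|]; apply: W => //; rewrite eq_sym.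
  rewrite eqn_mod_dvd ?leq_mul2r ?ll ?orbT // -mulnBl Gauss_dvdl 1?coprime_sym // => d.
  apply/val_inj/eqP; rewrite eqn_leq ll andbT -subn_eq0.
  by apply: contraTT d => n0; rewrite gtnNdvd ?lt0n //; have := ltn_ord l; lia.
transitivity (\sum_(l < y.+1) (b <= l <= s)).
  rewrite [RHS](reindex_inj hi) /=; apply: eq_bigr => l _.
  by rewrite /low hE.
transitivity (\sum_(0 <= l < y.+1) (b <= l <= s)); first by rewrite big_mkord.
rewrite (@big_cat_nat _ _ _ s.+1) //=.
have -> : \sum_(s.+1 <= l < y.+1) (b <= l <= s) = 0.
  rewrite big_nat_cond big1 // => l /andP[/andP[h1 _] _].
  by rewrite (leqNgt l) h1 andbF.
rewrite addn0.
case: b; last first.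
  rewrite big_nat_cond (eq_bigr (fun=> 1)); last first.
    by move=> l /andP[/andP[_ h2] _]; move: h2; rewrite ltnS => ->.
  by rewrite -big_nat_cond sum_nat_const_nat muln1.
rewrite big_ltn //= add0n big_nat_cond (eq_bigr (fun=> 1)).
  by rewrite -big_nat_cond sum_nat_const_nat muln1.
by move=> l /andP[/andP[h1 h2] _]; move: h2; rewrite ltnS h1 => ->.
Qed.

Lemma stair_addy b k y c i : 0 < y -> coprime c y ->
  stair b k y c (i + y) = stair b k y c i + (k.+1 - b).
Proof.
move=> y0 cy; elim: i => [|i IH].
  rewrite add0n stair0 add0n /stair sum_low // ?ltn_mod //.
  by have := divn_eq k y; case: b => /=; lia.
by rewrite addSn !stairS IH -addSn low_period; lia.
Qed.

Lemma stair_modn b k y c i : 0 < y -> coprime c y ->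
  stair b k y c i = stair b k y c (i %% y) %[mod k.+1 - b].
Proof.
move=> y0 cy; rewrite {1}(divn_eq i y) addnC; elim: (i %/ y) => [|w IH].
  by rewrite mul0n addn0.
by rewrite mulSn [y + _]addnC addnA stair_addy // modnDr.
Qed.

(** The two markings differ only at gaps whose number is a multiple of [y], and no such gap occurs
    before index [y]. *)
Lemma stair_agree b k y c i : coprime c y -> i < y ->
  stair b k y c i = stair false k y c i.
Proof.
move=> cy; elim: i => [|i IH] iy; first by rewrite !stair0.
rewrite !stairS IH ?(ltnW iy) //; congr (_ + _).
rewrite /low; case: b {IH} => //=; have : i.+1 * c %% y != 0; last by rewrite -lt0n => ->.
by rewrite -/(dvdn _ _) Gauss_dvdl 1?coprime_sym // gtnNdvd.
Qed.

(** For [b = false] the period [k + 1] closes with a marked gap, of length [k %/ y + 1]. This value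
    is the future degree of [stairpoly]. *)
Lemma stair_last b k y c : 0 < y -> coprime c y ->
  stair b k y c y.-1 = k - k %/ y.
Proof.
move=> y0 cy; rewrite stair_agree ?prednK //.
have := @stair_addy false k y c 0 y0 cy; rewrite add0n stair0 add0n subn0 => e.
by have := stairS false k y c y.-1; rewrite prednK // e /low modnMr /=; lia.
Qed.

(** The reflection [r -> s + b - r] preserves the interval from [b] to [s]. Passing from [c] to [-c]
    changes the sign of residues, and translating the index by [(s + b) / c] modulo [y] supplies the
    rest of the reflection. *)
Lemma low_opp b y c s l x : c < y -> s < y -> c * x = 1 %[mod y] ->
  low b y (y - c) s l = low b y c s (l + (s + b) * x).
Proof.
move=> cy sy cx; have y0 : 0 < y by lia.
rewrite /low.
have -> : (l + (s + b) * x) * c %% y = (l * c %% y + s + b) %% y.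
  have e : (s + b) * (c * x) = s + b %[mod y] by rewrite -modnMmr cx modnMmr muln1.
  by rewrite -addnA modnDml mulnDl -mulnA [x * c]mulnC -modnDmr e modnDmr.
have -> : l * (y - c) %% y = (y - l * c %% y) %% y.
  have h : l * (y - c) + l * c = l * y by rewrite -mulnDr subnK // ltnW.
  have u := ltn_pmod (l * c) y0.
  have e : l * (y - c) + l * c %% y = y - l * c %% y + l * c %% y %[mod y].
    by rewrite modnDmr h (subnK (ltnW u)) modnMl modnn.
  by apply/eqP; move/eqP: e; rewrite eqn_modDr.
have := ltn_pmod (l * c) y0; move: (l * c %% y) => u uy.
have e v : v < y -> v %% y = v by move=> ?; rewrite modn_small.
case: (posnP u) => [->|u0].
  rewrite subn0 modnn add0n; case: b; rewrite ?addn0 ?addn1.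
    case: (ltnP s.+1 y) => h; first by rewrite e //; lia.
    have -> : s.+1 = y by lia.
    by rewrite modnn.
  by rewrite e //; lia.
rewrite (e (y - u)); last lia.
case: (ltnP (u + s + b) y) => h; first by rewrite e //; lia.
have -> : (u + s + b) %% y = u + s + b - y.
  by rewrite -{1}(subnK h) modnDr e //; lia.
lia.
Qed.

Lemma stair_opp b k y c i x : c < y -> c * x = 1 %[mod y] ->
  stair b k y c (i + (k %% y + b) * x) =
  stair b k y (y - c) i + stair b k y c ((k %% y + b) * x).
Proof.
move=> cy cx; elim: i => [|i IH]; first by rewrite stair0.
by rewrite addSn !stairS IH -addSn (low_opp _ _ _ _ cx) ?ltn_pmod //; lia.
Qed.

Lemma coprime_opp y c : c < y -> coprime c y -> coprime (y - c) y.
Proof.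
move=> cy; have := subnKC (ltnW cy); move: (y - c) => d <-.
by rewrite /coprime gcdnDl gcdnDr gcdnC.
Qed.

Local Open Scope ring_scope.

(** * The kernel as a module of polynomial pairs *)

(** This is the Laurent symbol of the Toeplitz matrix times [X^k]: its coefficients are [-1] below
    degree [k], [0] at [k], and [1] from [k + 1] to [2k]. The factored form is the one suited to
    divisibility. *)
Definition symbol (k : nat) : {poly rat} := ('X^k - 1) * \sum_(i < k.+1) 'X^i.

Lemma subX1_geom (F : comNzRingType) (M : nat) :
  'X^M - 1 = ('X - 1) * \sum_(i < M) 'X^i :> {poly F}.
Proof. by rewrite subrX1. Qed.

Lemma coprimep_subXn1_geom k : (0 < k)%N ->
  coprimep ('X^k - 1 : {poly rat}) (\sum_(i < k.+1) 'X^i).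
Proof.
move=> k0; rewrite subX1_geom coprimepMl; apply/andP; split.
  rewrite coprimep_sym -[1]/(1%:P) coprimep_XsubC /root horner_sum.
  under eq_bigr do rewrite hornerXn expr1n.
  by rewrite sumr_const card_ord pnatr_eq0.
(* Consecutive geometric sums satisfy [G_(k+1) - X G_k = 1]. *)
apply/Bezout_eq1_coprimepP; exists (- 'X, 1) => /=.
rewrite big_ord_recl /= mul1r mulNr expr0 addrCA mulr_sumr.
under [X in - X]eq_bigr do rewrite -exprS.
by rewrite addNr addr0.
Qed.

(** The two binomials have greatest common divisor [X - 1], and [symbol k] contains this factor
    once: it is their least common multiple. *)
Lemma symbol_dvd k f : (0 < k)%N ->
  (symbol k %| f) = ('X^k - 1 %| f) && ('X^(k.+1) - 1 %| f).
Proof.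
move=> k0; rewrite Gauss_dvdp ?coprimep_subXn1_geom //.
apply/andP/andP => -[h1 h2]; split=> //; last first.
  by apply: dvdp_trans h2; rewrite subX1_geom dvdp_mull.
have : symbol k %| f by rewrite Gauss_dvdp ?coprimep_subXn1_geom // h1 h2.
apply: dvdp_trans; rewrite /symbol !subX1_geom.
by rewrite mulrAC dvdp_mulr.
Qed.

Lemma size_symbol k : (0 < k)%N -> size (symbol k) = (2 * k).+1.
Proof.
move=> k0.
have s1 : size ('X^k - 1 : {poly rat}) = k.+1 by rewrite size_XnsubC.
have s2 : size (\sum_(i < k.+1) 'X^i : {poly rat}) = k.+1.
  have := @size_XnsubC rat k.+1 1 isT.
  rewrite polyC1 subX1_geom -[X in 'X - X]/(1%:P) size_proper_mul ?size_XsubC.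
    by rewrite /= => -[].
  rewrite lead_coefXsubC mul1r lead_coef_eq0.
  apply/eqP => h; have := @size_XnsubC rat k.+1 1 isT.
  by rewrite polyC1 subX1_geom h mulr0 size_poly0.
rewrite /symbol size_mul ?s1 ?s2; first by lia.
  by rewrite -size_poly_eq0 s1.
by rewrite -size_poly_eq0 s2.
Qed.

Lemma symbol_neq0 k : (0 < k)%N -> symbol k != 0.
Proof. by move=> k0; rewrite -size_poly_eq0 size_symbol. Qed.

Lemma coef_geom (M i : nat) :
  (\sum_(j < M) 'X^j : {poly rat})`_i = (i < M)%N%:R.
Proof.
have -> : \sum_(j < M) 'X^j = \poly_(j < M) 1 :> {poly rat}.
  by rewrite poly_def; apply: eq_bigr => j _; rewrite scale1r.
by rewrite coef_poly; case: ifP.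
Qed.

Lemma coef_symbol k i :
  (symbol k)`_i = ((k < i) && (i <= 2 * k))%N%:R - (i < k)%N%:R.
Proof.
rewrite /symbol mulrBl mul1r coefB coefXnM !coef_geom.
case: ltngtP => h /=; first by rewrite ltnS ltnW.
  have -> : (i < k.+1)%N = false by lia.
  by rewrite !subr0; congr (_%:R); lia.
by rewrite -h subnn /= ltnSn subrr subr0.
Qed.

Lemma coprimep_X_symbol k t : (0 < k)%N -> coprimep (symbol k) 'X^t.
Proof.
move=> k0; apply: coprimep_expr; rewrite coprimepX /root horner_coef0 coef_symbol.
by rewrite k0.
Qed.

(** For [t1 = 0] and [t2 = n + k] this is the divisibility behind [ker_Amat]. Having two exponents
    keeps the roles of [p] and [q] symmetric and absorbs powers of [X] multiplying either of
    them. *)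
Definition relmod (k t1 t2 : nat) (p q : {poly rat}) : bool :=
  symbol k %| 'X^t1 * p + 'X^t2 * q.

Lemma relmod_sym k t1 t2 p q : relmod k t1 t2 p q = relmod k t2 t1 q p.
Proof. by rewrite /relmod addrC. Qed.

Lemma relmodB k t1 t2 p q p' q' :
  relmod k t1 t2 p q -> relmod k t1 t2 p' q' -> relmod k t1 t2 (p - p') (q - q').
Proof.
rewrite /relmod => h h'; have := dvdp_sub h h'.
by rewrite !mulrBr opprD addrACA.
Qed.

Lemma relmodM k t1 t2 u p q :
  relmod k t1 t2 p q -> relmod k t1 t2 (u * p) (u * q).
Proof.
rewrite /relmod => h; have := dvdp_mull u h.
by rewrite mulrDr !(mulrCA u).
Qed.

Lemma relmodX k t1 t2 p q : (0 < k)%N ->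
  relmod k t1 t2 ('X * p) ('X * q) -> relmod k t1 t2 p q.
Proof.
rewrite /relmod => k0.
by rewrite !(mulrCA _ 'X) -mulrDr -{1}['X]expr1 Gauss_dvdpr // coprimep_X_symbol.
Qed.

(** Eliminating between the two relations shows that [symbol k] divides [p' q - p q'] times a power
    of [X]. The sizes keep the determinant below degree [2k], so it vanishes. *)
Lemma relmod_det k t1 t2 p q p' q' d D : (0 < k)%N ->
  relmod k t1 t2 p q -> relmod k t1 t2 p' q' ->
  (size p <= d)%N -> (size q <= d)%N -> (size p' <= D)%N -> (size q' <= D)%N ->
  (d + D <= (2 * k).+1)%N -> p' * q = p * q'.
Proof.
move=> k0 h h' sp sq sp' sq' dD; apply/eqP; rewrite -subr_eq0; apply/eqP.
have dv : symbol k %| 'X^t1 * (p' * q - p * q').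
  have -> : 'X^t1 * (p' * q - p * q') =
     q * ('X^t1 * p' + 'X^t2 * q') - q' * ('X^t1 * p + 'X^t2 * q) by ring.
  by rewrite dvdp_sub // dvdp_mull.
rewrite Gauss_dvdpr ?coprimep_X_symbol // in dv.
apply/eqP; apply: contraTT isT => nz; have := dvdp_leq nz dv.
rewrite size_symbol // ltnNge (leq_trans (size_polyD _ _)) // size_polyN geq_max.
apply/andP; split; apply: leq_trans (size_polyMleq _ _) _.
  by rewrite -subn1 leq_subLR (leq_trans (leq_add sp' sq)) // addnC add1n.
by rewrite -subn1 leq_subLR (leq_trans (leq_add sp sq')) // add1n.
Qed.

Lemma mulX_divp (r : {poly rat}) : r`_0 = 0 -> r = 'X * (r %/ 'X).
Proof.
move=> r0; rewrite mulrC divpK // -['X]subr0 -polyC0 dvdp_XsubCl /root horner_coef0.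
by rewrite r0.
Qed.

(* Descent on the degree: subtract a scalar multiple of [(P, Q)] to kill the constant terms
   (they are proportional because the determinant vanishes), then divide by ['X]. *)
Lemma relmod_generator k t1 t2 P Q d : (0 < k)%N -> (d <= k)%N ->
  relmod k t1 t2 P Q -> (size P <= d.+1)%N -> (size Q <= d.+1)%N -> Q`_0 != 0 ->
  (forall p q, relmod k t1 t2 p q -> (size p <= k)%N -> (size q <= k)%N ->
     q`_0 != 0 -> (d < maxn (size p) (size q))%N) ->
  forall D p q, (D <= k)%N -> relmod k t1 t2 p q ->
    (size p <= D)%N -> (size q <= D)%N ->
  exists2 u : {poly rat}, (size u <= D - d)%N & p = u * P /\ q = u * Q.
Proof.
move=> k0 dk hPQ sP sQ Q0 min; elim=> [|D IH] p q Dk hpq sp sq.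
  exists 0; rewrite ?size_poly0 // !mul0r.
  by split; apply/eqP; rewrite -size_poly_leq0.
pose a := q`_0 / Q`_0.
(* By minimality a nonzero constant term forces degree at least [d]; hence the subtracted multiple
   of [(P, Q)] never exceeds the current size bound. *)
have aD : a != 0 -> (d <= D)%N.
  rewrite mulf_eq0 negb_or => /andP[q0 _].
  have := min _ _ hpq (leq_trans sp Dk) (leq_trans sq Dk) q0.
  by move/leq_trans => /(_ D.+1); rewrite geq_max sp sq ltnS; apply.
have det : p * Q = P * q by apply: (relmod_det k0 hPQ hpq sP sQ sp sq); lia.
have p0 : p`_0 = a * P`_0.
  have := congr1 (fun r : {poly rat} => r`_0) det; rewrite !coef0M => e.
  by apply: (mulIf Q0); rewrite e /a; field.
pose p1 := (p - a%:P * P) %/ 'X; pose q1 := (q - a%:P * Q) %/ 'X.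
have ep : p - a%:P * P = 'X * p1 by apply: mulX_divp; rewrite coefB coefCM p0 subrr.
have eq : q - a%:P * Q = 'X * q1.
  by apply: mulX_divp; rewrite coefB coefCM /a divfK ?subrr.
have szX (r r1 R0 : {poly rat}) : r - a%:P * R0 = 'X * r1 -> (size r <= D.+1)%N ->
    (size R0 <= d.+1)%N -> (size r1 <= D)%N.
  move=> e sr sR; have : (size (r - a%:P * R0)%R <= D.+1)%N.
    apply: leq_trans (size_polyD _ _) _; rewrite size_polyN geq_max sr /=.
    case: (eqVneq a 0) => [->|/[dup] /aD dD an0]; first by rewrite mul0r size_poly0.
    by rewrite mul_polyC size_scale // (leq_trans sR).
  rewrite e; case: (eqVneq r1 0) => [->|n0]; first by rewrite size_poly0.
  by rewrite mulrC size_mulX.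
have hp1 : relmod k t1 t2 p1 q1.
  by apply: relmodX => //; rewrite -ep -eq relmodB // relmodM.
have [u su [eu1 eu2]] := IH _ _ (ltnW Dk) hp1
  (szX _ _ _ ep sp sP) (szX _ _ _ eq sq sQ).
exists (a%:P + 'X * u).
  apply: leq_trans (size_polyD _ _) _; rewrite geq_max; apply/andP; split.
    rewrite size_polyC; case: (eqVneq a 0) => //= /aD; lia.
  case: (eqVneq u 0) => [->|n0]; first by rewrite mulr0 size_poly0.
  have dD : (0 < D - d)%N by apply: leq_trans su; rewrite size_poly_gt0.
  by rewrite mulrC size_mulX // (leq_ltn_trans su) //; lia.
split; rewrite mulrDl -mulrA.
  by rewrite -eu1 -ep addrC subrK.
by rewrite -eu2 -eq addrC subrK.
Qed.

Lemma mul_Amat n k (v : 'rV[rat]_n) (j : 'I_n) :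
  (v *m Amat n k) 0 j = (symbol k * rVpoly v)`_(j + k).
Proof.
have -> : rVpoly v = \sum_(l < n) (v 0 l)%:P * 'X^l.
  rewrite /rVpoly poly_def; apply: eq_bigr => l _.
  by rewrite mul_polyC valK.
rewrite mxE mulr_sumr coef_sum; apply: eq_bigr => l _.
rewrite mulrCA coefCM coefMXn mxE; congr (_ * _).
rewrite coef_symbol; case: (ltnP (j + k) l) => h1.
  have -> : (l < j)%N = false by lia.
  by rewrite andbF.
have -> : (k < j + k - l)%N = (l < j)%N by lia.
have -> : (j + k - l < k)%N = (j < l)%N by lia.
have -> : (j + k - l <= 2 * k)%N = (j <= l + k)%N by lia.
rewrite andbT; case: ltngtP => h /=; rewrite ?sub0r ?subr0 //.
by case: leqP.
Qed.

(** The equations say that the coefficients of the product from [k] to [n + k - 1] vanish; [p] and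
    [q] collect what remains below and above. *)
Lemma ker_Amat n k (v : 'rV[rat]_n) :
  v *m Amat n k = 0 <->
  exists p q : {poly rat}, [/\ (size p <= k)%N, (size q <= k)%N &
    symbol k * rVpoly v = p + 'X^(n + k) * q].
Proof.
split=> [vA|[p [q [sp sq e]]]]; last first.
  apply/rowP => j; rewrite mul_Amat e mxE coefD coefXnM ltn_add2r ltn_ord addr0.
  by rewrite nth_default // (leq_trans sp) // leq_addl.
have [->|k0] := posnP k.
  exists 0, 0; rewrite size_poly0; split=> //.
  by rewrite /symbol expr0 subrr mul0r mulr0 addr0 mul0r.
pose f := symbol k * rVpoly v.
exists (take_poly k f), (drop_poly (n + k) f); split.
- exact: size_take_poly.
- rewrite size_drop_poly leq_subLR (leq_trans (size_polyMleq _ _)) //.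
  by rewrite size_symbol // addSn /= addnC -addnA mul2n -addnn leq_add2r size_poly.
- apply/polyP => i; rewrite coefD coefXnM coef_take_poly coef_drop_poly.
  case: (ltnP i k) => h1.
    by rewrite (leq_trans h1 (leq_addl _ _)) addr0.
  case: (ltnP i (n + k)) => h2; last by rewrite subnK ?add0r.
  have hi : (i - k < n)%N by lia.
  have := congr1 (fun w : 'rV__ => w 0 (Ordinal hi)) vA.
  by rewrite mul_Amat mxE /= subnK // addr0.
Qed.

(** Let [h] be the quotient of [P + X^(n+k) Q] by [symbol k]. Multiplication by [h] carries the
    polynomials of size at most [k - d] bijectively onto the kernel; the rows of [B] are the
    [X^i h]. *)
Lemma nullity_Amat n k P Q d : (0 < k)%N -> (0 < n)%N -> (d <= k)%N ->
  relmod k 0 (n + k) P Q -> (size P <= d.+1)%N -> (size Q <= d.+1)%N -> Q != 0 ->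
  (forall p q, relmod k 0 (n + k) p q -> (size p <= k)%N -> (size q <= k)%N ->
    exists2 u : {poly rat}, (size u <= k - d)%N & p = u * P /\ q = u * Q) ->
  nullity (Amat n k) = (k - d)%N.
Proof.
move=> k0 n0 dk rPQ sP sQ Q0 gen.
have [h eh] : exists h : {poly rat}, P + 'X^(n + k) * Q = symbol k * h.
  by case/dvdpP: rPQ => h; rewrite expr0 mul1r => ->; exists h; rewrite mulrC.
(* The degree of [P] is below [n + k], so [P] cannot cancel [X^(n+k) Q]. *)
have h0 : h != 0.
  apply: contraNneq Q0 => z; move/eqP: eh; rewrite z mulr0 => /eqP eh.
  apply/eqP/polyP => i; have := congr1 (fun r : {poly rat} => r`_(i + (n + k))) eh.
  rewrite coefD coefXnM ltnNge leq_addl /= addnK nth_default ?add0r ?coef0 //.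
  by rewrite (leq_trans sP) // (leq_trans _ (leq_addl _ _)) //; lia.
have sh : (size h + (k - d) <= n.+1)%N.
  have : (size (P + 'X^(n + k) * Q)%R <= n + k + d.+1)%N.
    apply: leq_trans (size_polyD _ _) _; rewrite geq_max (leq_trans sP) ?leq_addl //=.
    by rewrite mulrC size_mulXn // leq_add2l.
  rewrite eh size_mul ?symbol_neq0 // size_symbol //.
  have aux a : (((2 * k).+1 + a).-1 <= n + k + d.+1 -> a + (k - d) <= n.+1)%N by lia.
  exact: aux.
pose B : 'M[rat]_(k - d, n) := \matrix_i poly_rV ('X^i * h).
have mulB (u : 'rV_(k - d)) : rVpoly (u *m B) = rVpoly u * h.
  rewrite -[u *m B](_ : poly_rV (rVpoly u * h) = _) ?poly_rV_K //.
    have [->|u0] := eqVneq (rVpoly u) 0; first by rewrite mul0r size_poly0.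
    have su : (size (rVpoly u) <= k - d)%N by apply: size_poly.
    rewrite size_mul // -ltnS prednK ?(leq_trans _ (leq_addr _ _)) ?size_poly_gt0 //.
    by rewrite addnC (leq_trans _ sh) // leq_add2l.
  rewrite mulmx_sum_row /rVpoly poly_def mulr_suml linear_sum; apply: eq_bigr => i _.
  by rewrite valK rowK -scalerAl linearZ.
have Bfree : row_free B.
  apply: inj_row_free => u /(congr1 rVpoly); rewrite mulB linear0 => /eqP.
  rewrite mulf_eq0 (negPf h0) orbF => /eqP/(congr1 (@poly_rV _ (k - d))).
  by rewrite rVpolyK linear0.
have -> : nullity (Amat n k) = \rank (kermx (Amat n k)) by rewrite mxrank_ker.
rewrite -[RHS](eqP Bfree); apply/eqP; rewrite eqn_leq; apply/andP; split.
  apply: mxrankS; apply/rV_subP => v /sub_kermxP/ker_Amat[p [q [sp sq e]]].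
  have [|u su [eu1 eu2]] := gen p q _ sp sq.
    by rewrite /relmod mul1r -e dvdp_mulr.
  have -> : v = poly_rV u *m B; last exact: submxMl.
  apply: (can_inj rVpolyK); rewrite mulB poly_rV_K //.
  apply: (mulfI (symbol_neq0 k0)).
  by rewrite e eu1 eu2 [RHS]mulrCA -eh; ring.
apply: mxrankS; apply/row_subP => i; rewrite rowK; apply/sub_kermxP/ker_Amat.
have sX (r : {poly rat}) : (size r <= d.+1)%N -> (size ('X^i * r)%R <= k)%N.
  move=> sr; have [->|r0] := eqVneq r 0; first by rewrite mulr0 size_poly0.
  rewrite mulrC size_mulXn // (leq_trans (leq_add (leqnn _) sr)) //; have := ltn_ord i; lia.
exists ('X^i * P), ('X^i * Q); split; [exact: sX | exact: sX |].
rewrite poly_rV_K; last first.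
  rewrite mulrC size_mulXn // -ltnS -addSn (leq_trans _ sh) // addnC leq_add2l.
  exact: ltn_ord.
by rewrite [LHS]mulrCA -eh; ring.
Qed.

(** * Tents *)

Lemma dvdp_subXn_modn M a b : a = b %[mod M] ->
  ('X^M - 1 : {poly rat}) %| 'X^a - 'X^b.
Proof.
wlog ab : a b / (a <= b)%N.
  move=> W e; case/orP: (leq_total a b) => h; first exact: W.
  by rewrite -dvdpNr opprB; apply: W.
move=> /eqP; rewrite eq_sym eqn_mod_dvd // => /dvdnP[w e].
have -> : b = (a + M * w)%N by lia.
have -> : 'X^a - 'X^(a + M * w) = - 'X^a * ('X^M ^+ w - 1) :> {poly rat}.
  by rewrite exprD exprM; ring.
by rewrite dvdp_mull // ['X^M ^+ w - 1]subrX1 dvdp_mulr.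
Qed.

Lemma coef_dvd_subXn1 M t (p q : {poly rat}) a b : 'X^M - 1 %| p + 'X^t * q ->
  (size p <= M)%N -> (size q <= M)%N -> (a < M)%N -> (b < M)%N ->
  b = (a + t)%N %[mod M] -> p`_b = - q`_a.
Proof.
move=> dv sp sq aM bM e; have M0 : (0 < M)%N by lia.
(* [r] is the reduction of [p + X^t q] modulo [X^M - 1]; being divisible by [X^M - 1] and of smaller
   degree, it is zero. *)
pose r := p + \sum_(i < M) q`_i *: 'X^((i + t) %% M).
have r0 : r = 0.
  apply/eqP; apply: contraTT isT => nz.
  suff dr : 'X^M - 1 %| r.
    have := dvdp_leq nz dr; rewrite -polyC1 size_XnsubC // ltnNge => /negP[].
    apply: leq_trans (size_polyD _ _) _; rewrite geq_max sp /=.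
    apply: leq_trans (size_sum _ _ _) _; apply/bigmax_leqP => i _.
    by apply: leq_trans (size_scale_leq _ _) _; rewrite size_polyXn ltn_mod.
  have -> : r = (p + 'X^t * q) - \sum_(i < M) q`_i *: ('X^(i + t) - 'X^((i + t) %% M)).
    rewrite [X in 'X^t * X](_ : q = \sum_(i < M) q`_i *: 'X^i); last first.
      rewrite -poly_def; apply/polyP => i; rewrite coef_poly; case: ltnP => // h.
      by rewrite nth_default // (leq_trans sq).
    rewrite mulr_sumr -addrA -sumrB; congr (_ + _); apply: eq_bigr => i _.
    by rewrite -scalerAr -exprD [(t + i)%N]addnC -scalerBr opprB addrC subrK.
  rewrite dvdp_sub //; apply: (big_ind (fun f => 'X^M - 1 %| f)) => [|f g|i _].
  - exact: dvdp0.
  - exact: dvdp_add.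
  - by rewrite -mul_polyC dvdp_mull // dvdp_subXn_modn // modn_mod.
have := congr1 (fun f : {poly rat} => f`_b) r0; rewrite coefD coef_sum coef0.
rewrite (bigD1 (Ordinal aM)) //= big1 => [|i ia].
  by rewrite coefZ coefXn -e (modn_small bM) eqxx mulr1 addr0 => /eqP; rewrite addr_eq0 => /eqP.
rewrite coefZ coefXn; case: eqP => [ib|]; last by rewrite mulr0.
case/eqP: ia; apply: val_inj => /=.
have : (i + t = a + t %[mod M])%N by rewrite -e ib modn_mod.
move/eqP; rewrite eqn_modDr (modn_small aM) modn_small; last exact: ltn_ord.
by move/eqP.
Qed.

(** As [x] is a unit modulo [y], translation by [x] is a single cycle on the residues. Only the step
    leaving [y - 1] is missing, and a cycle with one link removed is still connected. *)
Lemma rotation_const (T : Type) (f : nat -> T) (v : T) y x w :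
  (0 < y)%N -> (x * w = 1 %[mod y])%N -> (forall i, f (i %% y)%N = f i) ->
  (forall i, (i < y.-1)%N -> f (i + x)%N = f i) -> f y.-1 = v -> forall i, f i = v.
Proof.
move=> y0 xw per step v0.
have fmod a b : a = b %[mod y] -> f a = f b by move=> e; rewrite -(per a) e per.
have back u : (u <= y)%N -> f (y.-1 + (y - u) * x)%N = v.
  elim: u => [|u IH] uy.
    by rewrite subn0 -v0; apply: fmod; rewrite addnC mulnC modnMDl.
  have := IH (ltnW uy); set r := (y.-1 + (y - u.+1) * x)%N.
  have -> : (y.-1 + (y - u) * x = r + x)%N.
    by rewrite /r -addnA -mulSnr subnSK.
  move=> IHr; have [rl|rl] := eqVneq (r %% y)%N y.-1; first by rewrite -per rl.
  have ry := ltn_pmod r y0.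
  by rewrite -per -step ?(fmod _ (r + x)%N) ?modnDml //; lia.
move=> i; rewrite -(back (y - (i.+1 * w) %% y)%N) ?leq_subr // subKn; last first.
  by rewrite ltnW // ltn_pmod.
apply: fmod; rewrite -modnDmr modnMml -mulnA [(w * x)%N]mulnC.
by rewrite -modnMmr xw modnMmr muln1 modnDmr -addSnnS prednK // modnDl.
Qed.

Definition stairpoly (k y c : nat) : {poly rat} :=
  \sum_(i < y) 'X^(stair false k y c i).

(** The translation [(s + b) / c] of [stair_opp], relating the staircases of [y - c] and [c]. *)
Definition tent_shift (b : bool) (k y c : nat) : nat :=
  ((k %% y + b) * invmod y c)%N.

(** The modulus is [k + 1] for [b = false] and [k] for [b = true]. Only the first exponent of the
    [y - c] side is matched here; [stair_opp] then matches all of them. *)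
Definition aligned (k y c t1 t2 : nat) : Prop :=
  forall b : bool, (t2 + stair b k y c (tent_shift b k y c) = t1 %[mod k.+1 - b])%N.

Lemma stair_aligned k y c t1 t2 (b : bool) i : (c < y)%N -> coprime c y ->
  aligned k y c t1 t2 -> (i < y)%N ->
  (t1 + stair false k y (y - c) i =
   t2 + stair false k y c ((i + tent_shift b k y c) %% y) %[mod k.+1 - b])%N.
Proof.
move=> cy co al iy; have y0 : (0 < y)%N by lia.
rewrite -(stair_agree b) ?coprime_opp // -[in RHS](stair_agree b) ?ltn_pmod //.
rewrite -[in RHS]modnDmr -stair_modn // modnDmr /tent_shift stair_opp ?mul_invmod //.
have alb := al b; rewrite /tent_shift in alb.
by rewrite addnCA -[in RHS]modnDmr alb modnDmr addnC.
Qed.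

(** Modulo [X^k - 1] and modulo [X^(k+1) - 1] both sums have the same terms up to a rotation of the
    index. The two rotations differ by [1 / c], which is what the minimality lemmas exploit. *)
Lemma stairpoly_relmod k y c t1 t2 : (c < y)%N -> (y <= k)%N -> coprime c y ->
  aligned k y c t1 t2 ->
  relmod k t1 t2 (- stairpoly k y (y - c)) (stairpoly k y c).
Proof.
move=> cy yk co al; have y0 : (0 < y)%N by lia.
suff dv (b : bool) : 'X^(k.+1 - b) - 1 %|
    'X^t1 * - stairpoly k y (y - c) + 'X^t2 * stairpoly k y c.
  rewrite /relmod symbol_dvd; last by lia.
  by have := dv true; have := dv false; rewrite subn0 subn1 /= => -> ->.
pose h (i : 'I_y) : 'I_y := Ordinal (ltn_pmod (i + tent_shift b k y c) y0).
have hi : injective h.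
  move=> i i' /(congr1 val) /= /eqP; rewrite eqn_modDr.
  by rewrite !modn_small // => /eqP/val_inj.
rewrite /stairpoly [X in _ + 'X^t2 * X](reindex_inj hi) /= mulrN !mulr_sumr.
rewrite [X in _ %| X]addrC -sumrB.
apply: (big_ind (fun f => 'X^(k.+1 - b) - 1 %| f)) => [|f g|i _].
- exact: dvdp0.
- exact: dvdp_add.
rewrite -!exprD; apply: dvdp_subXn_modn.
by apply/esym/stair_aligned.
Qed.

Lemma stair_le_last b k y c i : (0 < y <= k)%N -> coprime c y -> (i < y)%N ->
  (stair b k y c i <= k - k %/ y)%N.
Proof.
move=> yk co iy; rewrite -(stair_last b k _ co); last by lia.
by rewrite leqNgt ltn_stair // -leqNgt; lia.
Qed.

Lemma stair_lt_last b k y c i : (0 < y <= k)%N -> coprime c y -> (i < y.-1)%N ->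
  (stair b k y c i < k - k %/ y)%N.
Proof.
move=> yk co iy; rewrite -(stair_last b k _ co); last by lia.
by rewrite ltn_stair.
Qed.

Lemma stairpoly_coef0 k y c : (0 < y <= k)%N -> (stairpoly k y c)`_0 = 1.
Proof.
case: y => // y yk; rewrite /stairpoly coef_sum big_ord_recl big1 /=.
  by rewrite stair0 expr0 coef1 addr0.
move=> i _; rewrite coefXn; case: eqP => // e.
by have := ltn_stair false c yk 0 (lift ord0 i); rewrite stair0 -e.
Qed.

Lemma size_stairpoly k y c : (0 < y <= k)%N -> coprime c y ->
  (size (stairpoly k y c) <= (k - k %/ y).+1)%N.
Proof.
move=> yk co; apply: leq_trans (size_sum _ _ _) _; apply/bigmax_leqP => i _.
by rewrite size_polyXn ltnS stair_le_last.
Qed.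

Lemma coef_relmod (b : bool) k t (p q : {poly rat}) i j : (0 < k)%N -> relmod k 0 t p q ->
  (size p <= k)%N -> (size q <= k)%N -> (i < k.+1 - b)%N -> (j < k.+1 - b)%N ->
  (j = i + t %[mod k.+1 - b])%N -> p`_j = - q`_i.
Proof.
move=> k0; rewrite /relmod symbol_dvd // expr0 mul1r => /andP[d1 d2] sp sq ib jb e.
apply: coef_dvd_subXn1 e => //.
- by case: b ib jb => _ _; rewrite ?subn0 ?subn1.
- by apply: leq_trans sp _; case: b {ib jb}; lia.
- by apply: leq_trans sq _; case: b {ib jb}; lia.
Qed.

Lemma tent_shift_true k y c : tent_shift true k y c = (tent_shift false k y c + invmod y c)%N.
Proof. by rewrite /tent_shift addn1 mulSn addn0 addnC. Qed.

(* Comparing coefficients modulo [X^(k+1) - 1] and modulo [X^k - 1] shows that [q] is constant on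
   the support of [stairpoly k y c]; if the degree were too small that constant would be [0]. *)
Lemma relmod_min_right k y c t j p q : (c < y)%N -> (y <= k)%N -> coprime c y ->
  aligned k y c j t -> (j <= k %/ y)%N -> relmod k 0 t p q ->
  (size p <= k)%N -> (size q <= k)%N -> q`_0 != 0 ->
  (k - k %/ y + j < maxn (size p) (size q))%N.
Proof.
move=> cy yk co al jm hpq sp sq; apply: contraNT; rewrite -leqNgt geq_max => /andP[sp' _].
have y0 : (0 < y)%N by lia.
have yk' : (0 < y <= k)%N by rewrite y0.
have mk : (k %/ y <= k)%N by apply: leq_div.
pose f i := q`_(stair false k y c ((i + tent_shift false k y c) %% y)).
have rel (b : bool) i : (i < y)%N -> (stair false k y (y - c) i + j < k.+1 - b)%N ->
    p`_(stair false k y (y - c) i + j) = - q`_(stair false k y c ((i + tent_shift b k y c) %% y)).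
  move=> iy h; apply: coef_relmod hpq _ _ _ h _ => //; first by lia.
    have := @stair_le_last false k y c ((i + tent_shift b k y c) %% y) yk' co (ltn_pmod _ y0).
    have : (0 < k %/ y)%N by rewrite divn_gt0.
    by case: b => ? ?; lia.
  by rewrite addnC (stair_aligned b cy co al iy) addnC.
have cop := coprime_opp cy co.
have inv : (invmod y c * c = 1 %[mod y])%N by rewrite mulnC mul_invmod.
have fE : f (y.-1 * tent_shift false k y c)%N = q`_0.
  by rewrite /f -mulSnr prednK // modnMr stair0.
rewrite -fE; apply/eqP; apply: (rotation_const (v := 0) y0 inv) => [i|i iy|].
- by rewrite /f modnDml.
(* Before the last index the exponent is below [k], so both moduli apply and the two values of [q]
   agree. *)
- have lt := stair_lt_last false yk' cop iy.
  apply: oppr_inj; rewrite /f -addnA [(invmod y c + _)%N]addnC -tent_shift_true.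
  by rewrite -!rel //; lia.
(* At the last index the exponent is [k - k %/ y + j], where [p] vanishes by its size. It may equal
   [k], so only the modulus [k + 1] is used. *)
- apply: oppr_inj; rewrite /f -rel ?oppr0 ?stair_last //; try lia.
  by rewrite nth_default.
Qed.

(** Mirror image of [relmod_min_right]: the size bound on [q] provides the zero value, and the index
    is read on the [c] staircase, so the rotation is by [-1 / c]. *)
Lemma relmod_min_left k y c t l p q : (c < y)%N -> (y <= k)%N -> coprime c y ->
  aligned k y c 0 (t + l) -> (l <= k %/ y)%N -> relmod k 0 t p q ->
  (size p <= k)%N -> (size q <= k)%N -> p`_0 != 0 ->
  (k - k %/ y + l < maxn (size p) (size q))%N.
Proof.
move=> cy yk co al lm hpq sp sq; apply: contraNT; rewrite -leqNgt geq_max => /andP[_ sq'].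
have y0 : (0 < y)%N by lia.
have yk' : (0 < y <= k)%N by rewrite y0.
have mk : (k %/ y <= k)%N by apply: leq_div.
have m0 : (0 < k %/ y)%N by rewrite divn_gt0.
have cop := coprime_opp cy co.
pose f i := - q`_(stair false k y c (i %% y) + l).
have rel (b : bool) i : (i < y)%N ->
    (stair false k y c ((i + tent_shift b k y c) %% y) + l < k.+1 - b)%N ->
    p`_(stair false k y (y - c) i) = f (i + tent_shift b k y c)%N.
  move=> iy h; apply: coef_relmod hpq _ _ h _ _ => //; first by lia.
    have := @stair_le_last false k y (y - c) i yk' cop iy.
    by case: b => ?; lia.
  by have := stair_aligned b cy co al iy; rewrite add0n => ->; congr (_ %% _)%N; lia.
have inv : (y.-1 * invmod y c * (y.-1 * c) = 1 %[mod y])%N.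
  rewrite mulnACA [(invmod y c * c)%N]mulnC -modnMmr mul_invmod // modnMmr muln1.
  (* [y - 1] plays the part of [-1]; the quotient [y - 2] in its square is correct only for
     [y > 1]. *)
  have [->//|y1] := eqVneq y 1%N.
  have -> : (y.-1 * y.-1 = (y - 2) * y + 1)%N by nia.
  by rewrite modnMDl.
have f0 i : f i = 0.
  apply: (rotation_const (v := 0) y0 inv) => {i} [i|i iy|].
  - by rewrite /f modn_mod.
  - have [u uy e] : exists2 u, (u < y)%N & (u + tent_shift true k y c = i %[mod y])%N.
      exists ((i + y.-1 * tent_shift true k y c) %% y)%N; first exact: ltn_pmod.
      by rewrite modnDml -addnA -mulSnr prednK // addnC mulnC modnMDl.
    have lt := stair_lt_last false yk' co iy.
    have e1 : f i = f (u + tent_shift true k y c)%N by rewrite /f e.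
    rewrite e1 -(rel true) //; last by rewrite e modn_small; lia.
    rewrite (rel false) //; last first.
      have := @stair_le_last false k y c ((u + tent_shift false k y c) %% y) yk' co (ltn_pmod _ y0).
      lia.
    have e2 : (i + y.-1 * invmod y c = u + tent_shift false k y c %[mod y])%N.
      rewrite -modnDml -e modnDml tent_shift_true -!addnA -mulSn prednK //.
      by rewrite addnA addnC mulnC modnMDl.
    by rewrite /f e2.
  - by rewrite /f modn_small ?prednK // stair_last // nth_default ?oppr0.
have := @rel false 0 y0; rewrite stair0 f0 => -> //.
have := @stair_le_last false k y c ((0 + tent_shift false k y c) %% y) yk' co (ltn_pmod _ y0).
by move: (stair _ _ _ _ _) => v; lia.
Qed.

Lemma relmod_shift k t j l p q :
  relmod k 0 t ('X^j * p) ('X^l * q) = relmod k j (t + l) p q.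
Proof. by rewrite /relmod expr0 mul1r mulrA -exprD. Qed.

Lemma size_XnM_stairpoly k y c j : (0 < y <= k)%N -> coprime c y ->
  (size ('X^j * stairpoly k y c)%R <= (k - k %/ y + j).+1)%N.
Proof.
move=> yk co; have n0 : stairpoly k y c != 0.
  apply: contraTneq (oner_neq0 rat) => z.
  by rewrite negbK -(stairpoly_coef0 c yk) z coef0.
rewrite mulrC size_mulXn // -addSn addnC leq_add2r; exact: size_stairpoly.
Qed.

(** Since [j] or [l] is zero, one member of the pair keeps a nonzero constant term, which is what
    the descent of [relmod_generator] starts from. *)
Lemma tent_generator k y c t j l : (c < y)%N -> (y <= k)%N -> coprime c y ->
  (j == 0%N) || (l == 0%N) -> aligned k y c j (t + l) -> (j + l <= k %/ y)%N ->
  forall D p q, (D <= k)%N -> relmod k 0 t p q -> (size p <= D)%N -> (size q <= D)%N ->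
  exists2 u : {poly rat}, (size u <= D - (k - k %/ y + (j + l)))%N &
    p = u * ('X^j * - stairpoly k y (y - c)) /\ q = u * ('X^l * stairpoly k y c).
Proof.
move=> cy yk co jl al jlm.
have y0 : (0 < y)%N by lia.
have yk' : (0 < y <= k)%N by rewrite y0.
have k0 : (0 < k)%N by lia.
have mk : (k %/ y <= k)%N by apply: leq_div.
have cop := coprime_opp cy co.
have h : relmod k 0 t ('X^j * - stairpoly k y (y - c)) ('X^l * stairpoly k y c).
  by rewrite relmod_shift stairpoly_relmod.
have dk : (k - k %/ y + (j + l) <= k)%N by lia.
have s1 : (size ('X^j * - stairpoly k y (y - c))%R <= (k - k %/ y + (j + l)).+1)%N.
  rewrite mulrN size_polyN; apply: leq_trans (size_XnM_stairpoly _ yk' cop) _.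
  by rewrite ltnS leq_add2l leq_addr.
have s2 : (size ('X^l * stairpoly k y c)%R <= (k - k %/ y + (j + l)).+1)%N.
  apply: leq_trans (size_XnM_stairpoly _ yk' co) _.
  by rewrite ltnS leq_add2l leq_addl.
case/orP: jl => /eqP z; last first.
  apply: (relmod_generator k0 dk h s1 s2).
    by rewrite z mul1r stairpoly_coef0 // oner_eq0.
  move=> p q rpq sp sq q0; rewrite z addn0; rewrite z !addn0 in al jlm.
  exact: relmod_min_right al jlm rpq sp sq q0.
(* For [j = 0] the constant term sits in the first member, so the descent is run with the two
   members exchanged. *)
rewrite relmod_sym in h => D p q Dk; rewrite relmod_sym => rpq sp sq.
have [||u su [e1 e2]] := relmod_generator k0 dk h s2 s1 _ _ Dk rpq sq sp.
- by rewrite z mul1r coefN stairpoly_coef0 ?oppr_eq0 ?oner_eq0 //; lia.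
- move=> q' p' r sq' sp' p0; rewrite z add0n; rewrite z !add0n in al jlm.
  by rewrite relmod_sym in r; rewrite maxnC; apply: relmod_min_left al jlm r sp' sq' p0.
by exists u.
Qed.

Lemma tent_nullity k y c n j l : (c < y)%N -> (y <= k)%N -> coprime c y -> (0 < n)%N ->
  (j == 0%N) || (l == 0%N) -> aligned k y c j (n + k + l) -> (j + l <= k %/ y)%N ->
  nullity (Amat n k) = (k %/ y - (j + l))%N.
Proof.
move=> cy yk co n0 jl al jlm.
have y0 : (0 < y)%N by lia.
have yk' : (0 < y <= k)%N by rewrite y0.
have mk : (k %/ y <= k)%N by apply: leq_div.
have cop := coprime_opp cy co.
have gen := tent_generator cy yk co jl al jlm (leqnn k).
rewrite (nullity_Amat _ _ _ _ _ _ _ gen); try lia.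
- by rewrite relmod_shift stairpoly_relmod.
- rewrite mulrN size_polyN; apply: leq_trans (size_XnM_stairpoly _ yk' cop) _.
  by rewrite ltnS leq_add2l leq_addr.
- apply: leq_trans (size_XnM_stairpoly _ yk' co) _.
  by rewrite ltnS leq_add2l leq_addl.
- rewrite mulf_eq0 expf_eq0 polyX_eq0 andbF /=; apply: contraTneq (oner_neq0 rat) => z.
  by rewrite negbK -(stairpoly_coef0 c yk') z coef0.
Qed.

(** * Distinct tents occupy distinct residues *)

Lemma XnM_inj (a b : nat) (A B : {poly rat}) : A`_0 = B`_0 -> B`_0 != 0 ->
  'X^a * A = 'X^b * B -> a = b /\ A = B.
Proof.
move=> AB B0 e.
have ab : a = b.
  have h (a' b' : nat) (A' B' : {poly rat}) :
    A'`_0 != 0 -> 'X^a' * A' = 'X^b' * B' -> (b' <= a')%N.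
    move=> A0 e'; rewrite leqNgt; apply: contra A0 => lt.
    have := congr1 (fun f : {poly rat} => f`_a') e'; rewrite !coefXnM ltnn subnn lt.
    by move=> ->.
  apply/eqP; rewrite eqn_leq; apply/andP; split; first by apply: h (esym e).
  by apply: h e; rewrite AB.
split=> //; move: e; rewrite ab; apply: mulfI.
by rewrite expf_eq0 polyX_eq0 andbF.
Qed.

(** Staircases increase strictly, so the sorted support of the polynomial is the list of their
    values. *)
Lemma stairpoly_inj k y c y' c' : (0 < y <= k)%N -> (0 < y' <= k)%N ->
  stairpoly k y c = stairpoly k y' c' ->
  y = y' /\ (forall i, (i < y)%N -> stair false k y c i = stair false k y' c' i).
Proof.
move=> yk yk' e.
have mem z d a : (stairpoly k z d)`_a != 0 = (a \in map (stair false k z d) (iota 0 z)).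
  rewrite /stairpoly coef_sum; under eq_bigr do rewrite coefXn.
  rewrite -natr_sum pnatr_eq0 sum_nat_eq0 negb_forall.
  apply/existsP/mapP => [[i]|[i]].
    by rewrite /= eqb0 negbK => /eqP->; exists (i : nat) => //; rewrite mem_iota /= ltn_ord.
  rewrite mem_iota /= => iz ->; exists (Ordinal iz).
  by rewrite /= eqxx.
have srt z d : (0 < z <= k)%N -> sorted ltn (map (stair false k z d) (iota 0 z)).
  move=> zk; rewrite sorted_map; apply: sub_sorted (iota_ltn_sorted 0 z) => i j /=.
  by rewrite ltn_stair.
have em : map (stair false k y c) (iota 0 y) = map (stair false k y' c') (iota 0 y').
  apply: (irr_sorted_eq ltn_trans ltnn); [exact: srt | exact: srt |].
  by move=> a; rewrite -!mem e.
have ey : y = y' by have := congr1 size em; rewrite !size_map !size_iota.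
split=> // i iy; have := congr1 (fun s => nth 0%N s i) em.
by rewrite !(nth_map 0%N) ?size_iota -?ey // !nth_iota.
Qed.

(** Values below the modulus and strict growth recover both shifts modulo [y] from the alignment.
    Their difference is [1 / c], which determines [c]. *)
Lemma aligned_inj k y c c' t1 t2 : (c < y)%N -> (c' < y)%N -> (y <= k)%N ->
  coprime c y -> coprime c' y -> aligned k y c t1 t2 -> aligned k y c' t1 t2 ->
  (forall i, (i < y)%N -> stair false k y c i = stair false k y c' i) -> c = c'.
Proof.
move=> cy cy' yk co co' al al' st; have y0 : (0 < y)%N by lia.
have yk' : (0 < y <= k)%N by rewrite y0.
have m0 : (0 < k %/ y)%N by rewrite divn_gt0.
have sh (b : bool) : (tent_shift b k y c = tent_shift b k y c' %[mod y])%N.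
  have := al b; rewrite -(al' b) => /eqP; rewrite eqn_modDl => /eqP.
  rewrite (stair_modn b) // [in RHS](stair_modn b) // !stair_agree ?ltn_pmod //.
  have bd z : (z < y)%N -> (stair false k y c z < k.+1 - b)%N.
    move=> zy; apply: leq_ltn_trans (stair_le_last false yk' co zy) _.
    by case: (b); lia.
  rewrite -(st (tent_shift b k y c' %% y)%N) ?ltn_pmod // !(modn_small (bd _ (ltn_pmod _ y0))) => e.
  by apply/eqP; case: ltngtP => // h; move: h; rewrite -(ltn_stair false c yk') e ltnn.
have inv : (invmod y c = invmod y c' %[mod y])%N.
  have := sh true; rewrite !tent_shift_true -modnDml (sh false) modnDml => /eqP.
  by rewrite eqn_modDl => /eqP.
have e1 : (c * (c' * invmod y c') = c %[mod y])%N.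
  by rewrite -modnMmr mul_invmod // modnMmr muln1.
have e2 : (c' * (c * invmod y c) = c' %[mod y])%N.
  by rewrite -modnMmr mul_invmod // modnMmr muln1.
have e3 : (c * (c' * invmod y c') = c' * (c * invmod y c) %[mod y])%N.
  by rewrite !mulnA [(c' * c)%N]mulnC -modnMmr -inv modnMmr.
by move: e1; rewrite e3 e2 (modn_small cy) (modn_small cy').
Qed.

(** Both pairs satisfy the same relation with the same degree bound [d], so the generator property
    compares them, and the constant terms [0], [1] or [-1] fix the scalar. The last hypothesis only
    breaks the symmetry between the pairs. *)
Lemma tent_poly_inj k t y c j l y' c' j' l' :
  (c < y)%N -> (y <= k)%N -> coprime c y -> (j == 0%N) || (l == 0%N) -> (j < k %/ y)%N ->
  aligned k y c j (t + l) -> (j + l <= k %/ y)%N ->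
  (c' < y')%N -> (y' <= k)%N -> coprime c' y' -> (j' == 0%N) || (l' == 0%N) -> (j' < k %/ y')%N ->
  aligned k y' c' j' (t + l') -> (j' + l' <= k %/ y')%N ->
  (k %/ y - (j + l) = k %/ y' - (j' + l'))%N -> ((0 < l) ==> (0 < l'))%N ->
  'X^j * - stairpoly k y (y - c) = 'X^j' * - stairpoly k y' (y' - c') /\
  'X^l * stairpoly k y c = 'X^l' * stairpoly k y' c'.
Proof.
move=> cy yk co jl jm al jlm cy' yk' co' jl' jm' al' jlm' ed ll.
have y0 : (0 < y <= k)%N by lia.
have y0' : (0 < y' <= k)%N by lia.
have k0 : (0 < k)%N by lia.
have mk : (k %/ y <= k)%N by apply: leq_div.
have mk' : (k %/ y' <= k)%N by apply: leq_div.
have cop := coprime_opp cy co.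
have cop' := coprime_opp cy' co'.
set P := 'X^j * _; set Q := 'X^l * _; set P' := 'X^j' * _; set Q' := 'X^l' * _.
have rel : relmod k 0 t P Q by rewrite relmod_shift stairpoly_relmod.
have rel' : relmod k 0 t P' Q' by rewrite relmod_shift stairpoly_relmod.
pose d := (k - k %/ y + (j + l))%N.
have ed' : (d = k - k %/ y' + (j' + l'))%N by rewrite /d; lia.
have sP : (size P <= d.+1)%N.
  rewrite /P mulrN size_polyN; apply: leq_trans (size_XnM_stairpoly _ y0 cop) _.
  by rewrite ltnS leq_add2l leq_addr.
have sQ : (size Q <= d.+1)%N.
  by apply: leq_trans (size_XnM_stairpoly _ y0 co) _; rewrite ltnS leq_add2l leq_addl.
have sP' : (size P' <= d.+1)%N.
  rewrite /P' mulrN size_polyN; apply: leq_trans (size_XnM_stairpoly _ y0' cop') _.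
  by rewrite ed' ltnS leq_add2l leq_addr.
have sQ' : (size Q' <= d.+1)%N.
  by apply: leq_trans (size_XnM_stairpoly _ y0' co') _; rewrite ed' ltnS leq_add2l leq_addl.
have c0 z e i : (0 < z <= k)%N -> ('X^i * stairpoly k z e)`_0 = (i == 0%N)%:R.
  by move=> zk; rewrite coefXnM; case: i => //=; rewrite stairpoly_coef0.
have gen := tent_generator cy yk co jl al jlm.
have [l0|l0] := posnP l.
  have dk : (d.+1 <= k)%N by rewrite /d; lia.
  have [u su [e1 e2]] := gen _ _ _ dk rel' sP' sQ'.
  have u1 : (size u <= 1)%N by apply: leq_trans su _; rewrite -/d subSnn.
  have uE := size1_polyC u1.
  have : Q'`_0 = u`_0 * Q`_0 by rewrite e2 coef0M.
  rewrite !c0 // l0 eqxx mulr1.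
  have [l0'|l0'] := posnP l'.
    by move=> e; rewrite e1 e2 uE -e polyC1 !mul1r.
  (* The scalar [u] would be zero, while [P'] has constant term [-1]. *)
  move=> e; exfalso.
  have j0' : j' = 0%N by lia.
  have := c0 y' (y' - c')%N j' y0'; rewrite {1}j0'.
  rewrite mul1r j0' eqxx => /eqP; rewrite -eqr_opp -coefN.
  have -> : - stairpoly k y' (y' - c') = P'.
    by rewrite /P' j0' mul1r.
  by rewrite e1 uE -e polyC0 mul0r coef0 eq_sym oppr_eq0 oner_eq0.
(* Here [d] may equal [k], so the generator property cannot be applied at size [d + 1]. The constant
   terms agree, so the difference is first divided by [X]; the quotient has size at most [d] and
   must be zero. *)
have l0' : (0 < l')%N by rewrite l0 in ll.
have j0 : j = 0%N by lia.
have j0' : j' = 0%N by lia.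
have divX (r : {poly rat}) : r`_0 = 0 -> exists r1, r = 'X * r1.
  by move=> r0; exists (r %/ 'X); apply: mulX_divp.
have [r1 er1] : exists r1, P - P' = 'X * r1.
  by apply: divX; rewrite coefB /P /P' !mulrN !coefN !c0 // j0 j0' subrr.
have [r2 er2] : exists r1, Q - Q' = 'X * r1.
  by apply: divX; rewrite coefB !c0 // !eqn0Ngt l0 l0' subrr.
have rr : relmod k 0 t r1 r2.
  by apply: relmodX => //; rewrite -er1 -er2 relmodB.
have sr (r A B : {poly rat}) : A - B = 'X * r ->
    (size A <= d.+1)%N -> (size B <= d.+1)%N -> (size r <= d)%N.
  move=> e sA sB; have : (size (A - B)%R <= d.+1)%N.
    by rewrite (leq_trans (size_polyD _ _)) // size_polyN geq_max sA.
  rewrite e; have [->|n0] := eqVneq r 0; first by rewrite size_poly0.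
  by rewrite mulrC size_mulX.
have dk : (d <= k)%N by rewrite /d; lia.
have [u su [e1 e2]] := gen _ _ _ dk rr (sr _ _ _ er1 sP sP') (sr _ _ _ er2 sQ sQ').
have u0 : u = 0 by apply/eqP; rewrite -size_poly_leq0 (leq_trans su) // -/d subnn.
by split; apply/eqP; rewrite -subr_eq0 ?er1 ?er2 ?e1 ?e2 u0 mul0r mulr0.
Qed.

Local Close Scope ring_scope.

Lemma tent_inj k t y c j l y' c' j' l' :
  c < y -> y <= k -> coprime c y -> (j == 0) || (l == 0) -> j < k %/ y ->
  aligned k y c j (t + l) -> j + l <= k %/ y ->
  c' < y' -> y' <= k -> coprime c' y' -> (j' == 0) || (l' == 0) -> j' < k %/ y' ->
  aligned k y' c' j' (t + l') -> j' + l' <= k %/ y' ->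
  k %/ y - (j + l) = k %/ y' - (j' + l') ->
  [/\ y = y', c = c', j = j' & l = l'].
Proof.
wlog ll : y c j l y' c' j' l' / (0 < l) ==> (0 < l').
  move=> W; have [h|] := boolP ((0 < l) ==> (0 < l')); first exact: W h.
  rewrite negb_imply => /andP[l0 l0'] *.
  have ll' : (0 < l') ==> (0 < l) by rewrite l0 implybT.
  by case: (W y' c' j' l' y c j l) => // -> -> -> ->.
move=> cy yk co jl jm al jlm cy' yk' co' jl' jm' al' jlm' ed.
have y0 : 0 < y <= k by lia.
have y0' : 0 < y' <= k by lia.
have [e1 e2] := tent_poly_inj cy yk co jl jm al jlm cy' yk' co' jl' jm' al' jlm' ed ll.
have [||ej _] := XnM_inj _ _ e1.
- by rewrite !coefN !stairpoly_coef0.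
- by rewrite coefN oppr_eq0 stairpoly_coef0 // oner_eq0.
have [||el eB] := XnM_inj _ _ e2.
- by rewrite !stairpoly_coef0.
- by rewrite stairpoly_coef0 // oner_eq0.
have [ey st] := stairpoly_inj y0 y0' eB.
subst y' j' l'; split=> //; exact: aligned_inj al al' st.
Qed.

(** * Residues attached to pairs, and the count of each nullity *)

(** The solution [n] of the alignment conditions by Chinese remainders. The factors [k] and [k - 1]
    stand for [-1] modulo [k + 1] and [k], avoiding subtraction. *)
Definition tent_index (k y c j l : nat) : nat :=
  chinese k.+1 k
    (j + k * (k + l + stair false k y c (tent_shift false k y c)))
    (j + k.-1 * (k + l + stair true k y c (tent_shift true k y c))) %% (k ^ 2 + k).

Lemma tent_index_aligned k y c j l : 0 < k -> aligned k y c j (tent_index k y c j l + k + l).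
Proof.
move=> k0; have co : coprime k.+1 k by apply: coprimeSn.
have kE : k ^ 2 + k = k.+1 * k by rewrite mulSn addnC mulnn.
move=> b; set S := stair b k y c _.
have -> : tent_index k y c j l + k + l + S = tent_index k y c j l + (k + l + S) by lia.
rewrite -modnDml /tent_index modn_dvdm; last first.
  by rewrite kE; case: b @S => _; [rewrite subn1 dvdn_mull | rewrite subn0 dvdn_mulr].
rewrite /S; case: b @S => _; rewrite ?subn0 ?subn1 /=.
  by rewrite chinese_modr // modnDml -addnA -mulSnr prednK // addnC mulnC modnMDl.
by rewrite chinese_modl // modnDml -addnA -mulSnr addnC mulnC modnMDl.
Qed.

Lemma Nnull_tent_index k y c j l : c < y -> y <= k -> coprime c y ->
  (j == 0) || (l == 0) -> j + l <= k %/ y ->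
  Nnull (tent_index k y c j l) k = k %/ y - (j + l).
Proof.
move=> cy yk co jl jlm; have k0 : 0 < k by lia.
have al := @tent_index_aligned k y c j l k0.
rewrite /Nnull; case: ltnP => kn.
  by apply: tent_nullity cy yk co _ jl al jlm; lia.
(* The representative used for [n <= k] is larger by [k (k + 1)], which preserves alignment for both
   moduli. *)
apply: tent_nullity cy yk co _ jl _ jlm; first by rewrite !addn_gt0 k0 !orbT.
move=> b; rewrite -(al b); set n := tent_index _ _ _ _ _; set S := stair _ _ _ _ _.
have -> : n + (k ^ 2 + k) + k + l + S = k ^ 2 + k + (n + k + l + S) by lia.
have kE : k ^ 2 + k = k.+1 * k by rewrite mulSn addnC mulnn.
rewrite kE; case: b @S => S; rewrite ?subn0 ?subn1 /= ?modnMDl //.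
by rewrite mulnC modnMDl.
Qed.

(* A pair [0 <= X < Y <= k] is encoded as [(X, Y - 1)]. *)
Definition pairs (k : nat) : {set 'I_k * 'I_k} := [set p : 'I_k * 'I_k | p.1 <= p.2].

Definition pair_gcd (k : nat) (p : 'I_k * 'I_k) : nat := gcdn p.1 p.2.+1.

(** The reduced fraction selects the tent and the gcd [g] a level in it. The side [b = false] has
    [j] from [0] to [m - 1] and includes the peak; the side [b = true] has [l] from [1] to [m],
    where [m = k %/ y]. A tent thus holds [2m] residues. *)
Definition pair_tent (k : nat) (p : 'I_k * 'I_k) (b : bool) : nat :=
  let g := pair_gcd p in
  let y := p.2.+1 %/ g in
  tent_index k y (p.1 %/ g)
    (if b then 0 else k %/ y - g) (if b then (k %/ y - g).+1 else 0).

Lemma pair_tentP (k : nat) (p : 'I_k * 'I_k) (b : bool) : p \in pairs k ->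
  let g := pair_gcd p in let y := p.2.+1 %/ g in let c := p.1 %/ g in
  let j := if b then 0 else k %/ y - g in let l := if b then (k %/ y - g).+1 else 0 in
  [/\ [/\ 0 < g, p.1 = c * g :> nat & p.2.+1 = y * g], c < y, y <= k, coprime c y &
      [/\ (j == 0) || (l == 0), j < k %/ y, j + l <= k %/ y, g <= k %/ y &
          k %/ y - (j + l) = g - b]].
Proof.
rewrite inE => le g y c j l.
have g0 : 0 < g by rewrite gcdn_gt0 orbT.
have d1 : g %| p.1 := dvdn_gcdl _ _.
have d2 : g %| p.2.+1 := dvdn_gcdr _ _.
have e1 : p.1 = c * g :> nat by rewrite /c divnK.
have e2 : p.2.+1 = y * g by rewrite /y divnK.
have y0 : 0 < y by move: e2; case: (y).
have cy : c < y by rewrite -(ltn_pmul2r g0) -e1 -e2 ltnS.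
have Yk := ltn_ord p.2.
have yk : y <= k by apply: leq_trans Yk; rewrite e2 leq_pmulr.
have co : coprime c y.
  by rewrite /coprime -(eqn_pmul2r g0) muln_gcdl -e1 -e2 mul1n.
have gm : g <= k %/ y by rewrite leq_divRL // mulnC -e2.
by split=> //; split=> //; rewrite /j /l; case: b {j l} => //=; lia.
Qed.

Lemma Nnull_pair_tent (k : nat) (p : 'I_k * 'I_k) (b : bool) : p \in pairs k ->
  Nnull (pair_tent p b) k = pair_gcd p - b.
Proof.
move=> /(pair_tentP b)[_ cy yk co [jl jm jlm _ <-]].
exact: Nnull_tent_index.
Qed.

(** Equal residues have equal nullity, so [tent_inj] identifies the tents and positions. Positivity
    of [l] reveals [b], and the nullity then gives the gcd. *)
Lemma pair_tent_inj (k : nat) (p p' : 'I_k * 'I_k) (b b' : bool) :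
  p \in pairs k -> p' \in pairs k -> pair_tent p b = pair_tent p' b' ->
  p = p' /\ b = b'.
Proof.
move=> pk pk' e.
have := Nnull_pair_tent b pk; rewrite e Nnull_pair_tent // => eg.
have [[g0 e1 e2] cy yk co [jl jm jlm _ ed]] := pair_tentP b pk.
have [[g0' e1' e2'] cy' yk' co' [jl' jm' jlm' _ ed']] := pair_tentP b' pk'.
have k0 : 0 < k by apply: leq_trans yk; apply: leq_ltn_trans cy.
have al := @tent_index_aligned k _ _ _ _ k0 : aligned k _ _ _ (pair_tent p b + k + _).
have al' := @tent_index_aligned k _ _ _ _ k0 : aligned k _ _ _ (pair_tent p' b' + k + _).
rewrite -e in al'.
have [|ey ec ej el] := tent_inj cy yk co jl jm al jlm cy' yk' co' jl' jm' al' jlm'.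
  by rewrite ed ed'.
have eb : b = b' by move: el; case: (b); case: (b').
have eg' : pair_gcd p = pair_gcd p' by move: eg g0 g0'; rewrite eb; clear; case: b' => /=; lia.
split=> //; move: e1 e2 e1' e2' ey ec eg'; clear.
case: p p' => [x y] [x' y'] /= e1 e2 e1' e2' ey ec eg.
congr pair; apply: val_inj => /=; first by rewrite e1 e1' ec eg.
by apply: succn_inj; rewrite e2 e2' ey eg.
Qed.

Definition gcd_count (k z : nat) : nat := #|[set p in pairs k | pair_gcd p == z]|.

Lemma card_set_sum (T : finType) (P : pred T) : #|[set x | P x]| = \sum_x P x.
Proof. by rewrite -sum1dep_card big_mkcond; apply: eq_bigr => x _; case: (P x). Qed.

Lemma card_pairs k : #|pairs k| * 2 = k ^ 2 + k.
Proof.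
have -> : #|pairs k| = \sum_(b < k) b.+1.
  rewrite card_set_sum -(pair_bigA _ (fun a b : 'I_k => nat_of_bool (a <= b))) exchange_big /=.
  apply: eq_bigr => b _.
  rewrite -[RHS]card_ord -sum1_card (big_ord_widen k (fun=> 1)) ?ltn_ord // [RHS]big_mkcond /=.
  by apply: eq_bigr => a _; rewrite ltnS; case: leqP.
elim: k => [|k IH]; first by rewrite big_ord0.
by rewrite big_ord_recr /= mulnDl IH; lia.
Qed.

(** The pairs with a side number exactly [k^2 + k], so the injection [h] into residues is onto.
    Nullity [z] comes from gcd [z] on one side and gcd [z + 1] on the other. *)
Lemma count_Nnull k z : 0 < z ->
  #|[set n : 'I_(k ^ 2 + k) | Nnull n k == z]| = gcd_count k z + gcd_count k z.+1.
Proof.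
move=> z0; have [->|k0] := posnP k.
  have e0 (T : finType) (A : {set T}) : #|T| = 0 -> #|A| = 0.
    by move=> T0; apply/eqP; rewrite -leqn0 -T0 max_card.
  by rewrite /gcd_count !e0 ?card_prod ?card_ord.
have K0 : 0 < k ^ 2 + k by rewrite addn_gt0 k0 orbT.
pose h (d : 'I_k * 'I_k * bool) : 'I_(k ^ 2 + k) :=
  Ordinal (ltn_pmod (pair_tent d.1 d.2) K0).
have hE d : h d = pair_tent d.1 d.2 :> nat by rewrite /= modn_mod.
pose D := [set d : 'I_k * 'I_k * bool | d.1 \in pairs k].
have hi : {in D &, injective h}.
  move=> [p b] [p' b']; rewrite !inE /= => pk pk' /(congr1 val).
  by rewrite /= !modn_mod => /pair_tent_inj []; rewrite ?inE // => -> ->.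
have cD : #|D| = k ^ 2 + k.
  have -> : D = finset.setX (pairs k) [set: bool]%SET.
    by apply/finset.setP => -[p b]; rewrite !inE andbT.
  by rewrite cardsX cardsT card_bool card_pairs.
have hD : h @: D = [set: 'I_(k ^ 2 + k)]%SET.
  by apply/eqP; rewrite eqEcard finset.subsetT cardsT card_ord card_in_imset // cD /=.
have -> : [set n : 'I_(k ^ 2 + k) | Nnull n k == z] =
          h @: [set d in D | pair_gcd d.1 - d.2 == z].
  apply/finset.setP => n; rewrite inE; apply/idP/imsetP => [|[d]].
    have : n \in h @: D by rewrite hD.
    case/imsetP => d dD -> e; exists d => //; move: e dD; rewrite !inE hE => e dD.
    by rewrite dD /=; rewrite Nnull_pair_tent ?inE in e.
  by rewrite !inE => /andP[dD e] ->; rewrite hE Nnull_pair_tent ?inE.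
rewrite card_in_imset; last first.
  by move=> d d'; rewrite !inE => /andP[d1 _] /andP[d2 _]; apply: hi; rewrite !inE.
transitivity (\sum_(p : 'I_k * 'I_k) \sum_(b : bool)
    ((p \in pairs k) && (pair_gcd p - b == z))).
  by rewrite card_set_sum pair_bigA; apply: eq_bigr => -[p b] _; rewrite !inE.
rewrite (eq_bigr (fun p => ((p \in pairs k) && (pair_gcd p - true == z)) +
  ((p \in pairs k) && (pair_gcd p - false == z)))) => [|p _]; last exact: big_bool.
rewrite big_split /= /gcd_count !card_set_sum addnC; congr (_ + _); apply: eq_bigr => p _.
  by rewrite subn0.
congr (nat_of_bool (_ && _)).
have : 0 < pair_gcd p by rewrite gcdn_gt0 orbT.
by rewrite /=; lia.
Qed.

Lemma sum_gcd_count k : \sum_(1 <= z < k.+1) gcd_count k z = #|pairs k|.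
Proof.
rewrite /gcd_count; under eq_bigr do rewrite card_set_sum.
rewrite exchange_big /= -sum1_card [RHS]big_mkcond /=; apply: eq_bigr => p _.
case: ifP => pk; last by rewrite big1.
have g0 : 0 < pair_gcd p by rewrite gcdn_gt0 orbT.
have gk : pair_gcd p <= k.
  by apply: leq_trans (ltn_ord p.2); apply: dvdn_leq; rewrite // dvdn_gcdr.
rewrite (bigD1_seq (pair_gcd p)) ?iota_uniq ?mem_index_iota ?g0 ?ltnS //= eqxx big1 // => z.
by rewrite eq_sym => /negPf->.
Qed.

Lemma gcd_count_div k z : 0 < z -> gcd_count k z = gcd_count (k %/ z) 1.
Proof.
move=> z0; set T := k %/ z.
have zT (a : 'I_T) : z * a + z <= k.
  by have := ltn_ord a; rewrite leq_divRL // mulSnr mulnC.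
have l1 (a : 'I_T) : z * a < k by have := zT a; lia.
(* The second coordinate encodes [Y - 1], so scaling [Y] by [z] sends it to [z * a + z - 1]. *)
have l2 (a : 'I_T) : z * a + z.-1 < k by have := zT a; lia.
pose h (p : 'I_T * 'I_T) := (Ordinal (l1 p.1), Ordinal (l2 p.2)).
have hg p : pair_gcd (h p) = z * pair_gcd p.
  by rewrite /pair_gcd /= -addnS prednK // -mulnSr muln_gcdr.
have hi : injective h.
  move=> [a b] [a' b'] [] /eqP; rewrite eqn_pmul2l // => /eqP/val_inj->.
  by move=> /eqP; rewrite eqn_add2r eqn_pmul2l // => /eqP/val_inj->.
rewrite /gcd_count -(card_imset _ hi); apply: eq_card => p.
rewrite inE; apply/idP/imsetP => [/andP[pk /eqP gz]|[q]].
  move: pk; rewrite inE => le.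
  have d1 : z %| p.1 by rewrite -gz dvdn_gcdl.
  have d2 : z %| p.2.+1 by rewrite -gz dvdn_gcdr.
  have Y0 : 0 < p.2.+1 %/ z by rewrite divn_gt0 // dvdn_leq.
  have b1 : (p.2.+1 %/ z).-1 < T by rewrite prednK // leq_div2r // ltn_ord.
  have a1 : p.1 %/ z < T.
    apply: leq_trans b1; rewrite prednK // ltn_divLR // divnK //.
  have e : h (Ordinal a1, Ordinal b1) = p.
    rewrite /h [RHS]surjective_pairing; congr pair; apply: val_inj => /=.
      by rewrite mulnC divnK.
    by move: (divnK d2) Y0; case: (_ %/ z) => // w; rewrite mulSn mulnC /=; lia.
  exists (Ordinal a1, Ordinal b1); rewrite ?e //.
  rewrite !inE /= -ltnS prednK // ltn_divLR // divnK // ltnS le /=.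
  by rewrite -(eqn_pmul2l z0) -hg e gz muln1.
rewrite !inE => /andP[le /eqP g1] ->; rewrite hg g1 muln1 eqxx andbT /=.
by rewrite (leq_trans _ (leq_addr _ _)) // leq_mul2l le orbT.
Qed.

Local Open Scope classical_set_scope.
Local Open Scope ring_scope.

(** * The Basel sum *)

Lemma sin_bounds (R : realType) (x : R) : 0 < x < pi / 2 -> x * cos x <= sin x <= x.
Proof.
move=> /andP[x0 xpi].
have [c] := @MVT R sin cos 0 x x0 (fun y _ => is_derive_sin y)
  (continuous_subspaceT (@continuous_sin R)).
rewrite in_itv /= => /andP[c0 cx]; rewrite sin0 !subr0 => ->.
rewrite mulrC ler_pM2r // ler_piMl ?cos_le1 ?(ltW x0) // andbT.
have pi0 := pi_gt0 R.
rewrite ltW // ltr_cos // in_itv /=; lra.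
Qed.

(** The left-hand side is the squared cotangent, so this is [x cos x <= sin x <= x] after squaring
    and inverting. *)
Lemma csc_bounds (R : realType) (x : R) : 0 < x < pi / 2 ->
  (sin x ^+ 2)^-1 - 1 <= (x ^+ 2)^-1 <= (sin x ^+ 2)^-1.
Proof.
move=> xpi; have s0 := sin_gt0_pihalf xpi; have /andP[h1 h2] := sin_bounds xpi.
case/andP: (xpi) => x0 xp.
have pi0 := pi_gt0 R.
have c0 : 0 < cos x by apply: cos_gt0_pihalf; lra.
apply/andP; split; last first.
  by rewrite lef_pV2 ?posrE ?exprn_gt0 //; apply: lerXn2r => //; rewrite nnegrE ltW.
have -> : (sin x ^+ 2)^-1 - 1 = cos x ^+ 2 / sin x ^+ 2.
  by rewrite cos2sin2; field; rewrite gt_eqF.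
rewrite ler_pdivrMr ?exprn_gt0 // [leRHS]mulrC ler_pdivlMr ?exprn_gt0 //.
rewrite -exprMn; apply: lerXn2r; last by rewrite mulrC.
  by rewrite nnegrE mulr_ge0 ?(ltW c0) ?(ltW x0).
by rewrite nnegrE (ltW s0).
Qed.

Definition odd_angle (R : realType) (n i : nat) : R := (i.*2.+1)%:R * pi / (2 ^ n.+2)%:R.

Lemma odd_angle_itv (R : realType) (n i : nat) : (i < 2 ^ n)%N ->
  0 < odd_angle R n i < pi / 2.
Proof.
move=> iN; have pi0 := pi_gt0 R.
have p0 : 0 < (2 ^ n.+2)%:R :> R by rewrite ltr0n expn_gt0.
rewrite /odd_angle divr_gt0 ?mulr_gt0 ?ltr0n ?expn_gt0 //=.
have -> : pi / 2 = (2 ^ n.+1)%:R * pi / (2 ^ n.+2)%:R :> R.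
  rewrite [(2 ^ n.+2)%N]expnS natrM.
  have : (2 ^ n.+1)%:R != 0 :> R by rewrite pnatr_eq0 expn_eq0.
  by move: ((2 ^ n.+1)%:R) => A A0; field.
by rewrite ltr_pM2r ?invr_gt0 // ltr_pM2r // ltr_nat expnS; lia.
Qed.

Lemma csc_double (R : realType) (x : R) : 0 < x < pi / 2 ->
  (sin x ^+ 2)^-1 + (sin (pi / 2 - x) ^+ 2)^-1 = 4 * (sin (x *+ 2) ^+ 2)^-1.
Proof.
move=> xpi; have s0 := sin_gt0_pihalf xpi.
have pi0 := pi_gt0 R.
have c0 : 0 < cos x by apply: cos_gt0_pihalf; lra.
have -> : sin (pi / 2 - x) = cos x.
  by rewrite sinB sin_pihalf cos_pihalf mul1r mul0r subr0.
rewrite sin_mulr2n.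
have e := cos2Dsin2 x.
have -> : (sin x ^+ 2)^-1 + (cos x ^+ 2)^-1 = (cos x ^+ 2 + sin x ^+ 2) / (cos x * sin x) ^+ 2.
  by field; rewrite !gt_eqF.
by rewrite e -mulr_natl; field; rewrite !gt_eqF.
Qed.

(** Pairing each angle [x] of level [n + 1] with [pi / 2 - x], [csc_double] gives four times the sum
    of level [n]. Level [0] is the single angle [pi / 4]. *)
Lemma sum_csc (R : realType) n :
  \sum_(i < 2 ^ n) (sin (odd_angle R n i) ^+ 2)^-1 = 2 * 4 ^+ n.
Proof.
elim: n => [|n IH].
  rewrite expn0 big_ord1 expr0 mulr1 /odd_angle /=.
  have xpi : 0 < (pi / 4 : R) < pi / 2 by have := pi_gt0 R; lra.
  have := csc_double xpi.
  have -> : pi / 2 - pi / 4 = pi / 4 :> R by lra.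
  have -> : (pi / 4) *+ 2 = pi / 2 :> R by rewrite -mulr_natl; field.
  rewrite sin_pihalf expr1n invr1 mul1r => h; lra.
have eN : (2 ^ n.+1 = 2 ^ n + 2 ^ n)%N by rewrite expnS; lia.
have -> : \sum_(i < 2 ^ n.+1) (sin (odd_angle R n.+1 i) ^+ 2)^-1 =
  \sum_(i < 2 ^ n) ((sin (odd_angle R n.+1 i) ^+ 2)^-1 +
     (sin (pi / 2 - odd_angle R n.+1 i) ^+ 2)^-1).
  rewrite -(big_mkord xpredT (fun i => (sin (odd_angle R n.+1 i) ^+ 2)^-1)).
  rewrite (@big_cat_nat _ _ _ (2 ^ n)%N) //= ?leq_exp2l // big_split /=; congr (_ + _).
    by rewrite big_mkord.
  rewrite big_nat_rev /= -{1}[(2 ^ n)%N]add0n big_addn.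
  have -> : (2 ^ n.+1 - 2 ^ n = 2 ^ n)%N by lia.
  rewrite big_mkord; apply: eq_bigr => i _; congr ((sin _ ^+ 2)^-1).
  rewrite /odd_angle.
  have -> : (2 ^ n + 2 ^ n.+1 - (i + 2 ^ n).+1 = 2 ^ n.+1 - i.+1)%N by lia.
  have iN := ltn_ord i.
  have -> : (2 ^ n.+1 - i.+1).*2.+1%:R = (2 ^ n.+2)%:R - i.*2.+1%:R :> R.
    rewrite -natrB; last by rewrite !expnS; lia.
    by congr (_%:R); rewrite !expnS; lia.
  have -> : (2 ^ n.+3)%:R = 2 * (2 ^ n.+2)%:R :> R by rewrite expnS natrM.
  have : (2 ^ n.+2)%:R != 0 :> R by rewrite pnatr_eq0 expn_eq0.
  by move: ((2 ^ n.+2)%:R) => A A0; field.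
rewrite exprS mulrCA -IH mulr_sumr; apply: eq_bigr => i _.
rewrite csc_double; last by apply: odd_angle_itv; rewrite eN (leq_trans (ltn_ord i)) // leq_addr.
congr (_ * (sin _ ^+ 2)^-1); rewrite /odd_angle -mulr_natl.
have -> : (2 ^ n.+3)%:R = 2 * (2 ^ n.+2)%:R :> R by rewrite expnS natrM.
have : (2 ^ n.+2)%:R != 0 :> R by rewrite pnatr_eq0 expn_eq0.
by move: ((2 ^ n.+2)%:R) => A A0; field.
Qed.

(** [csc_bounds] loses at most [1] on each of the [2^n] terms, against a sum of order [4^n]. *)
Lemma odd_invsq_bounds (R : realType) n :
  (pi ^+ 2 / 8 - pi ^+ 2 / 16 / 2 ^+ n : R) <=
  \sum_(i < 2 ^ n) ((i.*2.+1)%:R ^+ 2)^-1 <= (pi ^+ 2 / 8 : R).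
Proof.
have pi0 := pi_gt0 R.
set S := \sum_(i < _) _.
have e : \sum_(i < 2 ^ n) (odd_angle R n i ^+ 2)^-1 = 16 * 4 ^+ n / pi ^+ 2 * S.
  rewrite mulr_sumr; apply: eq_bigr => i _; rewrite /odd_angle natrX !exprS.
  have -> : 4 ^+ n = 2 ^+ n * 2 ^+ n :> R by rewrite -exprMn; congr (_ ^+ n); ring.
  have : 2 ^+ n != 0 :> R by rewrite expf_eq0 pnatr_eq0 andbF.
  have : i.*2.+1%:R != 0 :> R by rewrite pnatr_eq0.
  move: (lt0r_neq0 pi0); move: (2 ^+ n) (i.*2.+1%:R : R) (pi : R) => A a p p0 a0 A0; field.
  by rewrite A0 a0 p0.
have p0 : 0 < 2 ^+ n :> R by rewrite exprn_gt0.
have e4 : 4 ^+ n = 2 ^+ n * 2 ^+ n :> R by rewrite -exprMn; congr (_ ^+ n); ring.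
have up : 16 * 4 ^+ n / pi ^+ 2 * S <= 2 * 4 ^+ n.
  rewrite -e -sum_csc; apply: ler_sum => i _.
  by have /csc_bounds/andP[] := odd_angle_itv R (ltn_ord i).
have low : 2 * 4 ^+ n - 2 ^+ n <= 16 * 4 ^+ n / pi ^+ 2 * S.
  rewrite -e -sum_csc.
  have -> : 2 ^+ n = \sum_(i < 2 ^ n) 1 :> R by rewrite sumr_const card_ord natrX.
  rewrite -sumrB; apply: ler_sum => i _.
  by have /csc_bounds/andP[] := odd_angle_itv R (ltn_ord i).
move: up low; rewrite e4; move: (2 ^+ n : R) p0 => A A0.
have P0 : 0 < pi ^+ 2 :> R by rewrite exprn_gt0.
move: (pi ^+ 2 : R) P0 => B B0.
have AB : 0 < 16 * (A * A) / B by rewrite !(mulr_gt0, invr_gt0).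
move=> up low; apply/andP; split; rewrite -(ler_pM2l AB).
  have -> : 16 * (A * A) / B * (B / 8 - B / 16 / A) = 2 * (A * A) - A by field; rewrite !gt_eqF.
  exact: low.
have -> : 16 * (A * A) / B * (B / 8) = 2 * (A * A) by field; rewrite gt_eqF.
exact: up.
Qed.

Definition invsq_sum (R : realType) (k : nat) : R := \sum_(1 <= z < k.+1) (z%:R ^+ 2)^-1.

Lemma invsq_sumS (R : realType) k :
  invsq_sum R k.+1 = invsq_sum R k + (k.+1%:R ^+ 2)^-1.
Proof. by rewrite /invsq_sum big_nat_recr. Qed.

Lemma invsq_sum0 (R : realType) : invsq_sum R 0 = 0.
Proof. by rewrite /invsq_sum big_geq. Qed.

(** A telescoping comparison. The constant [7 / 4] leaves [3 / 4 < 1] once the term [z = 1] is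
    removed, which the later contraction needs. *)
Lemma invsq_sum_le (R : realType) k : invsq_sum R k.+2 <= 7 / 4 - k.+2%:R^-1.
Proof.
elim: k => [|k IH]; first by rewrite !invsq_sumS invsq_sum0; lra.
rewrite invsq_sumS; apply: le_trans (lerD IH (lexx _)) _.
rewrite -[k.+3]addn1 natrD; have : 0 < k.+2%:R :> R by rewrite ltr0n.
move: (k.+2%:R : R) => a a0.
have -> : 7 / 4 - a^-1 + ((a + 1) ^+ 2)^-1 =
   7 / 4 - (a + 1)^-1 - (a * (a + 1) ^+ 2)^-1 by field; rewrite gt_eqF ?gt_eqF //; lra.
by rewrite gerBl invr_ge0 mulr_ge0 ?exprn_ge0 //; lra.
Qed.

Lemma invsq_sum_le2 (R : realType) k : invsq_sum R k <= 7 / 4.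
Proof.
case: k => [|[|k]]; rewrite ?invsq_sumS ?invsq_sum0; [lra|lra|rewrite -invsq_sumS -invsq_sumS].
apply: le_trans (invsq_sum_le R k) _; rewrite gerBl invr_ge0; exact: ler0n.
Qed.

Lemma invsq_sum_nd (R : realType) : nondecreasing_seq (invsq_sum R).
Proof.
by apply/nondecreasing_seqP => k; rewrite invsq_sumS lerDl invr_ge0 exprn_ge0.
Qed.

Lemma invsq_sum_double (R : realType) N :
  invsq_sum R N.*2 = \sum_(i < N) ((i.*2.+1)%:R ^+ 2)^-1 + invsq_sum R N / 4.
Proof.
elim: N => [|N IH]; first by rewrite big_ord0 invsq_sum0 mul0r addr0.
rewrite doubleS !invsq_sumS IH big_ord_recr /= mulrDl.
have -> : (N.*2.+2)%:R = 2 * N.+1%:R :> R by rewrite -doubleS -mul2n natrM.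
have : N.+1%:R != 0 :> R by rewrite pnatr_eq0.
move: (N.+1%:R : R) (_ ^- 2) => a b a0.
rewrite exprMn invfM; move: (invsq_sum R N / 4) => ?.
have -> : (2 ^+ 2)^-1 = 4^-1 :> R by congr (_^-1); ring.
by ring.
Qed.

Lemma cvg_expn2 : (fun n => 2 ^ n)%N @ \oo --> \oo.
Proof.
apply/cvgnyPge => A; exists A => // n /= An.
by apply: leq_trans An _; apply: ltnW; apply: ltn_expl.
Qed.

Lemma basel (R : realType) : invsq_sum R @ \oo --> (pi ^+ 2 / 6 : R).
Proof.
have cZ : cvgn (invsq_sum R).
  apply: nondecreasing_is_cvgn; first exact: invsq_sum_nd.
  by exists (7 / 4) => _ [k _ <-]; apply: invsq_sum_le2.
set L := limn (invsq_sum R) in cZ *.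
have cL : invsq_sum R @ \oo --> L by exact: cZ.
have c2 : (fun n => invsq_sum R (2 ^ n)%N) @ \oo --> L.
  exact: (cvg_comp _ _ cvg_expn2 cL).
have c3 : (fun n => invsq_sum R (2 ^ n.+1)%N) @ \oo --> L.
  by move: c2; rewrite -cvg_shiftS.
have cO : (fun n => \sum_(i < 2 ^ n) ((i.*2.+1)%:R ^+ 2)^-1) @ \oo --> (pi ^+ 2 / 8 : R).
  apply: (@squeeze_cvgr _ _ _ _ (fun n => pi ^+ 2 / 8 - pi ^+ 2 / 16 / 2 ^+ n) (cst (pi ^+ 2 / 8))).
  - by near=> n; apply: odd_invsq_bounds.
  - rewrite -[X in _ --> X]subr0; apply: cvgB; first exact: cvg_cst.
    have -> : (fun n => pi ^+ 2 / 16 / 2 ^+ n) = geometric (pi ^+ 2 / 16) 2^-1 :> (nat -> R).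
      by apply/funext => n; rewrite /= exprVn.
    by apply: cvg_geometric; rewrite ger0_norm; lra.
  - exact: cvg_cst.
have c4 : (fun n => invsq_sum R (2 ^ n.+1)%N) @ \oo --> pi ^+ 2 / 8 + L / 4.
  have -> : (fun n => invsq_sum R (2 ^ n.+1)%N) =
    (fun n => \sum_(i < 2 ^ n) ((i.*2.+1)%:R ^+ 2)^-1 + invsq_sum R (2 ^ n)%N / 4).
    by apply/funext => n; rewrite expnS mul2n invsq_sum_double.
  by apply: cvgD => //; apply: cvgMl.
(* Splitting into odd and even terms along powers of two makes the limit a fixed point of this
   equation. *)
have e : L = pi ^+ 2 / 8 + L / 4 by apply: cvg_unique c3 c4.
have -> : pi ^+ 2 / 6 = L by lra.
exact: cL.
Unshelve. all: by end_near.
Qed.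

(** * Density of coprime pairs *)

Lemma divn_sqr_bounds (R : realType) (k z : nat) : (0 < z)%N ->
  0 <= ((k%:R / z%:R) ^+ 2 - (k %/ z)%:R ^+ 2 : R) <= 2 * k%:R / z%:R.
Proof.
move=> z0; have z0' : 0 < z%:R :> R by rewrite ltr0n.
have h1 : (k %/ z)%:R <= k%:R / z%:R :> R.
  by rewrite ler_pdivlMr // -natrM ler_nat leq_divM.
have h2 : k%:R / z%:R <= (k %/ z)%:R + 1 :> R.
  by rewrite ler_pdivrMr // natr1 -natrM ler_nat ltnW // ltn_ceil.
have h3 : 0 <= (k %/ z)%:R :> R by rewrite ler0n.
rewrite -mulrA; move: (k%:R / z%:R : R) ((k %/ z)%:R : R) h1 h2 h3 => r q *.
by apply/andP; split; nra.
Qed.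

Definition coprime_error (R : realType) (T : nat) : R :=
  (gcd_count T 1)%:R - 3 / pi ^+ 2 * T%:R ^+ 2.

Lemma density_itv (R : realType) : 0 < (3 / pi ^+ 2 : R) <= 3 / 4.
Proof.
have p2 := pi_ge2 R; have p0 : 0 < pi ^+ 2 :> R by rewrite exprn_gt0 // pi_gt0.
rewrite divr_gt0 //= ler_pM2l // lef_pV2 ?posrE //.
have -> : 4 = 2 ^+ 2 :> R by ring.
by apply: lerXn2r => //; rewrite nnegrE //; lra.
Qed.

Lemma gcd_count_le (R : realType) T : (gcd_count T 1)%:R <= T%:R ^+ 2 :> R.
Proof.
rewrite -natrX ler_nat.
have : (gcd_count T 1 <= #|pairs T|)%N.
  by apply: subset_leq_card; apply/fintype.subsetP => p; rewrite inE => /andP[].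
have := card_pairs T; nia.
Qed.

Lemma coprime_error_le (R : realType) T : `|coprime_error R T| <= T%:R ^+ 2.
Proof.
have /andP[a0 a1] := density_itv R.
have h := gcd_count_le R T; have g0 : 0 <= (gcd_count T 1)%:R :> R by rewrite ler0n.
rewrite /coprime_error ler_norml.
have T0 : 0 <= T%:R ^+ 2 :> R by rewrite exprn_ge0.
move: (3 / pi ^+ 2 : R) (T%:R ^+ 2 : R) ((gcd_count T 1)%:R : R) a0 a1 h g0 T0 => a t g *.
by apply/andP; split; nra.
Qed.

Lemma sum_coprime_error (R : realType) k :
  \sum_(1 <= z < k.+1) coprime_error R (k %/ z) =
  (k%:R ^+ 2 + k%:R) / 2 - 3 / pi ^+ 2 * \sum_(1 <= z < k.+1) (k %/ z)%:R ^+ 2.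
Proof.
rewrite /coprime_error sumrB -mulr_sumr; congr (_ - _).
have e : \sum_(1 <= z < k.+1) gcd_count (k %/ z) 1 = #|pairs k|.
  rewrite -sum_gcd_count; apply: eq_big_nat => z /andP[z0 _].
  by rewrite [RHS]gcd_count_div.
rewrite -natr_sum e; apply: (mulIf (_ : 2 != 0)) => //.
by rewrite -natrM card_pairs natrD natrX; field.
Qed.

(** The main terms cancel because [3 / pi^2] times [pi^2 / 6] is [1 / 2]. With [eps = 4 d], the
    Basel tail and the rounding errors each cost [d k^2], and the linear terms cost [2 d k^2]. *)
Lemma sum_coprime_error_small (R : realType) (eps : R) : 0 < eps ->
  \forall k \near \oo, `|\sum_(1 <= z < k.+1) coprime_error R (k %/ z)| <= eps * k%:R ^+ 2.
Proof.
move=> e0; have /andP[a0 a1] := density_itv R.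
have [d d0 eps4] : exists2 d : R, 0 < d & eps = 4 * d.
  by exists (eps / 4); [rewrite divr_gt0 | field].
have /cvgrPdist_le /(_ d d0) cB := @basel R.
near=> k.
have Bk : `|pi ^+ 2 / 6 - invsq_sum R k| <= d by near: k.
have k1 : 1 / 2 + 2 / d <= 2 * d * k%:R.
  rewrite [leRHS]mulrC -ler_pdivrMr ?mulr_gt0 //; near: k; exact: nbhs_infty_ger.
rewrite sum_coprime_error.
have sq : 0 <= k%:R ^+ 2 * invsq_sum R k - \sum_(1 <= z < k.+1) (k %/ z)%:R ^+ 2
            <= d * k%:R ^+ 2 + 2 * k%:R / d.
  rewrite /invsq_sum mulr_sumr -sumrB; apply/andP; split.
    rewrite big_nat_cond; apply: sumr_ge0 => z /andP[/andP[z0 _] _].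
    by have /andP[] := divn_sqr_bounds R k z0; rewrite exprMn exprVn.
  (* The inequality [2 / z <= d + 1 / (d z^2)] replaces the harmonic sum by the bounded sum of
     inverse squares. *)
  apply: (@le_trans _ _ (\sum_(1 <= z < k.+1) (d * k%:R + k%:R / d * (z%:R ^+ 2)^-1))).
    rewrite big_nat_cond [leRHS]big_nat_cond; apply: ler_sum => z /andP[/andP[z0 _] _].
    have /andP[_] := divn_sqr_bounds R k z0; rewrite exprMn exprVn => h.
    apply: le_trans h _; rewrite -exprVn.
    have : 0 <= k%:R * (d - z%:R^-1) ^+ 2 / d.
      by rewrite divr_ge0 ?(ltW d0) // mulr_ge0 ?ler0n // exprn_even_ge0.
    have -> : k%:R * (d - z%:R^-1) ^+ 2 / d =
      d * k%:R + k%:R / d * z%:R^-1 ^+ 2 - 2 * k%:R / z%:R.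
      have : z%:R != 0 :> R by rewrite pnatr_eq0 -lt0n.
      by move: (z%:R : R) => w w0; field; rewrite w0 gt_eqF.
    by rewrite subr_ge0.
  have cst : \sum_(1 <= z < k.+1) (d * k%:R) = d * k%:R ^+ 2.
    by rewrite sumr_const_nat subn1 -mulr_natr; ring.
  rewrite big_split /= cst -mulr_sumr.
  rewrite lerD2l -/(invsq_sum R k) [leRHS](_ : _ = k%:R / d * 2); last by ring.
  rewrite ler_wpM2l ?divr_ge0 ?(ltW d0) //.
  by apply: le_trans (invsq_sum_le2 R k) _; lra.
have aP : 3 / pi ^+ 2 * (pi ^+ 2 / 6) = 2^-1 :> R.
  have : pi ^+ 2 != 0 :> R by rewrite expf_neq0 // gt_eqF // pi_gt0.
  by move: (pi ^+ 2 : R) => P P0; field.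
have K0 : 0 <= k%:R :> R by rewrite ler0n.
have e2d : 2 * k%:R / d = 2 / d * k%:R by ring.
rewrite eps4; move: k1 sq Bk; rewrite e2d {e2d}.
move: aP a0 a1 K0 d0; move: (3 / pi ^+ 2 : R) (pi ^+ 2 / 6 : R) (invsq_sum R k) => a P Z.
move: (\sum_(1 <= z < k.+1) _) (k%:R : R) (2 / d) => S K c {eps4}.
move=> aP a0 a1 K0 d0 k1 /andP[s1 s2] /ler_normlP[b1 b2].
have KK : 0 <= K ^+ 2 by rewrite exprn_ge0.
have u1 : a * K ^+ 2 * (P - Z) <= d * K ^+ 2.
  apply: le_trans (_ : a * K ^+ 2 * d <= _); first by rewrite ler_wpM2l ?mulr_ge0 ?(ltW a0).
  by rewrite mulrAC ler_wpM2r // ler_piMl ?(ltW d0) //; lra.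
have u2 : a * K ^+ 2 * (Z - P) <= d * K ^+ 2.
  apply: le_trans (_ : a * K ^+ 2 * d <= _).
    by rewrite ler_wpM2l ?mulr_ge0 ?(ltW a0) //; lra.
  by rewrite mulrAC ler_wpM2r // ler_piMl ?(ltW d0) //; lra.
have u3 : 0 <= a * (K ^+ 2 * Z - S) by rewrite mulr_ge0 ?(ltW a0).
have u4 : a * (K ^+ 2 * Z - S) <= d * K ^+ 2 + c * K.
  by apply: le_trans s2; rewrite ler_piMl //; lra.
have u5 : K * (1 / 2 + c) <= K * (2 * d * K) by rewrite ler_wpM2l.
have -> : (K ^+ 2 + K) / 2 - a * S =
   a * K ^+ 2 * (P - Z) + K / 2 + a * (K ^+ 2 * Z - S) + K ^+ 2 * (2^-1 - a * P) by field.
rewrite aP subrr mulr0 addr0 ler_norml expr2; rewrite expr2 in u1 u2 u3 u4.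
by apply/andP; split; lra.
Unshelve. all: by end_near.
Qed.

Lemma coprime_error_small (R : realType) (eps : R) : 0 < eps ->
  \forall T \near \oo, `|coprime_error R T| <= eps * T%:R ^+ 2.
Proof.
(* The error at [k] is the small full sum minus the terms with [z >= 2]. The factor is
   [4/5 = 1/40 + 3/4 + 1/40]: full sum, terms with [k %/ z >= T0], and the at most [k] terms below
   [T0], each bounded by [T0^2]. *)
have contract (A : R) : 0 < A ->
    (\forall T \near \oo, `|coprime_error R T| <= A * T%:R ^+ 2) ->
    \forall T \near \oo, `|coprime_error R T| <= 4 / 5 * A * T%:R ^+ 2.
  move=> A0 [T0 _ hT].
  have A40 : 0 < A / 40 by rewrite divr_gt0.
  have small := sum_coprime_error_small A40.
  near=> k.
  have Sk : `|\sum_(1 <= z < k.+1) coprime_error R (k %/ z)| <= A / 40 * k%:R ^+ 2 by near: k.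
  have k0 : (0 < k)%N by near: k; exact: nbhs_infty_gt.
  have kT : T0%:R ^+ 2 <= A / 40 * k%:R.
    rewrite [leRHS]mulrC -ler_pdivrMr //; near: k; exact: nbhs_infty_ger.
  have bd z : (0 < z)%N ->
      `|coprime_error R (k %/ z)| <= A * k%:R ^+ 2 * (z%:R ^+ 2)^-1 + T0%:R ^+ 2.
    move=> z0; have /andP[q1 _] := divn_sqr_bounds R k z0.
    rewrite exprMn exprVn subr_ge0 in q1.
    case: (leqP T0 (k %/ z)) => h.
      apply: le_trans (hT _ h) _; rewrite -mulrA -[leLHS]addr0; apply: lerD.
        by rewrite ler_wpM2l ?(ltW A0).
      by rewrite exprn_ge0.
    apply: le_trans (coprime_error_le R _) _; rewrite -[leLHS]add0r; apply: lerD.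
      by rewrite !mulr_ge0 ?invr_ge0 ?exprn_ge0 ?(ltW A0).
    by apply: lerXn2r; rewrite ?nnegrE // ler_nat ltnW.
  have rest : `|\sum_(2 <= z < k.+1) coprime_error R (k %/ z)| <=
      A * k%:R ^+ 2 * (invsq_sum R k - 1) + k%:R * T0%:R ^+ 2.
    apply: le_trans (ler_norm_sum _ _ _) _.
    apply: (@le_trans _ _ (\sum_(2 <= z < k.+1) (A * k%:R ^+ 2 * (z%:R ^+ 2)^-1 + T0%:R ^+ 2))).
      rewrite big_nat_cond [leRHS]big_nat_cond; apply: ler_sum => z /andP[/andP[z0 _] _].
      by apply: bd; lia.
    rewrite big_split /= -mulr_sumr sumr_const_nat; apply: lerD.
      rewrite ler_wpM2l ?mulr_ge0 ?exprn_ge0 ?(ltW A0) //.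
      by rewrite /invsq_sum [in leRHS]big_ltn ?ltnS // mulr1n expr1n invr1 addrC addKr.
    rewrite -[leLHS]mulr_natl ler_wpM2r ?exprn_ge0 // ler_nat; lia.
  move: Sk; rewrite big_ltn // divn1 => Sk.
  have := ler_normB (coprime_error R k + \sum_(2 <= z < k.+1) coprime_error R (k %/ z))
    (\sum_(2 <= z < k.+1) coprime_error R (k %/ z)).
  rewrite addrK => tri.
  have Z2 := invsq_sum_le2 R k.
  have c1 : A * k%:R ^+ 2 * (invsq_sum R k - 1) <= A * k%:R ^+ 2 * (3 / 4).
    by rewrite ler_wpM2l ?mulr_ge0 ?exprn_ge0 ?(ltW A0) //; lra.
  have c2 : k%:R * T0%:R ^+ 2 <= A / 40 * k%:R ^+ 2.
    by rewrite expr2 [leRHS]mulrA [leRHS]mulrC ler_wpM2l.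
  apply: le_trans tri _; apply: le_trans (lerD Sk rest) _.
  apply: le_trans (lerD (lexx _) (lerD c1 c2)) _.
  have : 0 <= A * k%:R ^+ 2 by rewrite mulr_ge0 ?exprn_ge0 ?(ltW A0).
  rewrite -![A / 40 * _]mulrAC -[4 / 5 * A * _]mulrA; move: (A * k%:R ^+ 2) => t t0.
  by lra.
move=> e0.
(* Iterating the contraction from the trivial bound [T^2] makes the constant arbitrarily small. *)
have pow i : \forall T \near \oo, `|coprime_error R T| <= (4 / 5) ^+ i * T%:R ^+ 2.
  elim: i => [|i IH]; last by rewrite exprS; apply: contract => //; rewrite exprn_gt0 //; lra.
  by near=> T; rewrite expr0 mul1r coprime_error_le.
have /cvgrPdist_le /(_ eps e0) [i _ hi] := @cvg_geometric R 1 (4 / 5) ltac:(rewrite ger0_norm; lra).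
have := hi i (leqnn i); rewrite /= mul1r sub0r normrN ger0_norm; last by apply: exprn_ge0; lra.
move=> ie; near=> T; apply: le_trans (_ : (4 / 5) ^+ i * T%:R ^+ 2 <= _).
  by near: T; exact: pow.
by rewrite ler_wpM2r // exprn_ge0.
Unshelve. all: by end_near.
Qed.

Lemma gcd_count_density (R : realType) z : (0 < z)%N ->
  (fun k => (gcd_count k z)%:R / (k ^ 2 + k)%:R) @ \oo --> (3 / pi ^+ 2 * (z%:R ^+ 2)^-1 : R).
Proof.
move=> z0; apply/cvgrPdist_le => eps e0.
have /andP[a0 a1] := density_itv R.
have e2 : 0 < eps / 2 by rewrite divr_gt0.
have [T0 _ hT] := coprime_error_small e2.
near=> k.
(* The rounding error [2k] and the correction [k] from the denominator [k^2 + k] add up to [3k], to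
   be absorbed in [eps / 2 * k^2]. *)
have k1 : 6 <= eps * k%:R.
  rewrite [leRHS]mulrC -ler_pdivrMr //; near: k; exact: nbhs_infty_ger.
have k0 : 0 < k%:R :> R by rewrite ltr0n; near: k; exact: nbhs_infty_gt.
have kT : (T0 * z <= k)%N by near: k; exact: nbhs_infty_ge.
rewrite gcd_count_div //.
have : `|coprime_error R (k %/ z)| <= eps / 2 * (k %/ z)%:R ^+ 2.
  by apply: hT => /=; rewrite leq_divRL.
rewrite /coprime_error natrD natrX.
have /andP[s1 s2] := divn_sqr_bounds R k z0.
have w0 : 0 < z%:R^-1 :> R by rewrite invr_gt0 ltr0n.
have w1 : z%:R^-1 <= 1 :> R by rewrite invf_le1 ?ltr0n // ler1n.
move: w0 w1 s1 s2; rewrite -exprVn; move: a0 a1 k1 k0 ((gcd_count _ _)%:R : R).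
move: (3 / pi ^+ 2 : R) (k%:R : R) (z%:R^-1 : R) ((k %/ z)%:R : R) => a K w q.
move=> a0 a1 k1 k0 F w0 w1 s1 s2 /ler_normlP[f1 f2].
have M0 : 0 < K ^+ 2 + K by rewrite addr_gt0 ?exprn_gt0.
have -> : a * w ^+ 2 - F / (K ^+ 2 + K) =
   (a * (K * w) ^+ 2 + a * w ^+ 2 * K - F) / (K ^+ 2 + K) by field; rewrite gt_eqF.
rewrite normrM normfV (gtr0_norm M0) ler_pdivrMr //.
have rK : K * w <= K by rewrite ler_piMr // ltW.
have qK : q ^+ 2 <= K ^+ 2.
  apply: le_trans (_ : (K * w) ^+ 2 <= _); first by rewrite -subr_ge0.
  by apply: lerXn2r; rewrite ?nnegrE ?mulr_ge0 ?(ltW k0) ?(ltW w0).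
have t1 : a * ((K * w) ^+ 2 - q ^+ 2) <= 2 * K.
  apply: le_trans (_ : (K * w) ^+ 2 - q ^+ 2 <= _); first by rewrite ler_piMl //; lra.
  by apply: le_trans s2 _; rewrite -mulrA ler_wpM2l.
have t2 : 0 <= a * ((K * w) ^+ 2 - q ^+ 2) by rewrite mulr_ge0 ?(ltW a0).
have t3 : a * w ^+ 2 * K <= K.
  rewrite ler_piMl ?(ltW k0) // mulr_ile1 ?(ltW a0) ?exprn_ge0 ?exprn_ile1 ?(ltW w0) //; lra.
have t4 : 0 <= a * w ^+ 2 * K by rewrite !mulr_ge0 ?exprn_ge0 ?(ltW a0) ?(ltW w0) ?(ltW k0).
have t5 : eps / 2 * q ^+ 2 <= eps / 2 * K ^+ 2 by rewrite ler_wpM2l ?(ltW e2).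
have t6 : 3 * K <= eps / 2 * K ^+ 2.
  have -> : eps / 2 * K ^+ 2 = eps * K / 2 * K by field.
  by rewrite ler_wpM2r ?(ltW k0) //; lra.
have t7 : 0 < eps * K by rewrite mulr_gt0.
have t8 : eps / 2 * K ^+ 2 + eps / 2 * K ^+ 2 + eps * K = eps * (K ^+ 2 + K) by field.
rewrite mulrBr in t1 t2.
by rewrite ler_norml -t8; apply/andP; split; lra.
Unshelve. all: by end_near.
Qed.

Theorem theorem8p2 (R : realType) (z : nat) (hz : (1 <= z)%N) :
  (fun k : nat => Pz R z k) @ \oo -->
    (3 / pi ^+ 2 * ((z%:R ^+ 2)^-1 + ((z.+1)%:R ^+ 2)^-1) : R).
Proof.
rewrite mulrDr.
have -> : (fun k : nat => Pz R z k) =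
  (fun k => (gcd_count k z)%:R / (k ^ 2 + k)%:R + (gcd_count k z.+1)%:R / (k ^ 2 + k)%:R).
  by apply/funext => k; rewrite /Pz count_Nnull // natrD mulrDl.
by apply: cvgD; apply: gcd_count_density.
Qed.
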